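(* Let $X$ be a Polish space, $\Omega=C([0,+\infty)\to X)$, and let $\mathscr{P}$ be the space of Borel probability measures on $\Omega$. Let $\mathscr{C}:X\to 2^{\mathscr{P}}$ be a set-valued map such that: (C1) $\mathscr{C}(x)$ is a non-empty compact convex subset of $\mathscr{P}$ for every $x\in X$; (C2) $\{x\in X:\mathscr{C}(x)\cap K\neq\emptyset\}$ is a Borel subset of $X$ for every closed subset $K\subset\mathscr{P}$; (C3) $P(\Omega_x)=1$ for every $P\in\mathscr{C}(x)$ and every $x\in X$; (MP1) for every $x\in X$, $P\in\mathscr{C}(x)$ and $s\ge0$, $$P[\theta_s^{-1}(\cdot)\,|\,\mathcal{F}_s](w)\in\mathscr{C}(w(s))\quad (P,\mathcal{F}_s)\text{-a.s.};$$ (MP2) for every $x\in X$, $P\in\mathscr{C}(x)$ and $s\ge0$, if $w\mapsto Q_w$ is an $\mathcal{F}_s$-measurable selection of $w\mapsto\mathscr{C}(w(s))$, then $P\otimes_s Q\in\mathscr{C}(x)$. Then there exists a measurable selection $x\mapsto P_x\in\mathscr{C}(x)$, $x\in X$, such that for every $x\in X$ and $s\ge0$, $$P_x[\theta_s^{-1}(\cdot)\,|\,\mathcal{F}_s](w)=P_{w(s)}\quad(P_x,\mathcal{F}_s)\text{-a.s.}$$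
   Context: $\Omega$ is the space of continuous paths $w:[0,+\infty)\to X$ with the compact-open topology; $\Omega_x=\{w\in\Omega:w(0)=x\}$; $\mathcal{F}$ is the Borel $\sigma$-algebra of $\Omega$ and $\mathcal{F}_t$ is the $\sigma$-algebra generated by the coordinate maps $w\mapsto w(r)$, $0\le r\le t$. $\theta_s:\Omega\to\Omega$ is the shift $(\theta_s w)(t)=w(s+t)$. $\mathscr{P}$ carries the weak (weak$^*$) topology generated by the functionals $P\mapsto\int f\,dP$, $f\in C_b(\Omega)$ (bounded continuous functions). $P[\,\cdot\,|\mathcal{F}_s]$ is the regular conditional probability distribution of $P$ given $\mathcal{F}_s$, and $P[\theta_s^{-1}(\cdot)|\mathcal{F}_s](w)$ is the probability measure $B\mapsto P[\theta_s^{-1}(B)|\mathcal{F}_s](w)$ on $\mathcal{F}$. ''$(P,\mathcal{F}_s)$-a.s.'' means: for all $w$ outside a $P$-null set belonging to $\mathcal{F}_s$. A map $w\mapsto Q_w\in\mathscr{P}$ is $\mathcal{F}_s$-measurable if $w\mapsto\int f\,dQ_w$ is $\mathcal{F}_s$-measurable for every $f\in C_b(\Omega)$; it is a selection of $w\mapsto\mathscr{C}(w(s))$ if $Q_w\in\mathscr{C}(w(s))$ for every $w\in\Omega$. For such a $Q$ with each $Q_w$ supported on $\Omega_{w(s)}$, and for $P\in\mathscr{P}$, $P\otimes_s Q$ denotes the unique probability measure $R$ on $(\Omega,\mathcal{F})$ that agrees with $P$ on $\mathcal{F}_s$ and satisfies $R[\theta_s^{-1}(\cdot)|\mathcal{F}_s](w)=Q_w$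 for $R$-almost all $w$. A measurable selection is a Borel measurable map $X\to\mathscr{P}$, $x\mapsto P_x$, with $P_x\in\mathscr{C}(x)$ for all $x$. *)

(* Defs.v *)
From HB Require Import structures.
From mathcomp Require Import all_boot all_order all_algebra.
From mathcomp Require Import all_classical all_reals all_analysis.
From mathcomp Require Import measurable_realfun.

Set Implicit Arguments.
Unset Strict Implicit.
Unset Printing Implicit Defensive.

Import Order.TTheory GRing.Theory Num.Theory.
Import numFieldNormedType.Exports.

Local Open Scope classical_set_scope.
Local Open Scope ring_scope.

Definition is_metric (R : realType) (X : Type) (d : X -> X -> R) : Prop :=
  [/\ forall x y, d x y = 0 <-> x = y,
      forall x y, d x y = d y x &
      forall x y z, d x z <= d x y + d y z].

Definition metrizes (R : realType) (X : topologicalType)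
    (d : X -> X -> R) : Prop :=
  forall (x : X) (A : set X),
    nbhs x A <-> exists2 e, 0 < e & [set y | d x y < e] `<=` A.

Definition complete_metric (R : realType) (X : topologicalType)
    (d : X -> X -> R) : Prop :=
  forall u : nat -> X,
    (forall e, 0 < e ->
       exists N, forall m n, (N <= m)%N -> (N <= n)%N -> d (u m) (u n) < e) ->
    exists l : X, u @ \oo --> l.

Definition polish (R : realType) (X : topologicalType) : Prop :=
  (exists2 D : set X, countable D & dense D) /\
  (exists d : X -> X -> R, [/\ is_metric d, metrizes d & complete_metric d]).

Definition borel (T : ptopologicalType) : measurableType (@open T).-sigma :=
  g_sigma_algebraType (@open T).

Lemma continuous_borel (S T : ptopologicalType) (f : S -> T) :
  continuous f -> measurable_fun [set: borel S] (f : borel S -> borel T).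
Proof.
move=> /continuousP cf.
apply: (@measurability _ _ (borel S) (borel T) setT f (@open T)) => //.
by move=> _ [A oA <-]; rewrite setTI; apply: sub_sigma_algebra; exact: cf.
Qed.

(* A [probability] of the library is a function on all subsets, whose values
   on non-measurable ones are unconstrained.  Normalizing these to 0 makes
   Leibniz equality on [prob] the equality of measures on the Borel
   sigma-algebra (see [prob_eqP]); without this, distinct elements could be
   indistinguishable for the weak topology. *)
Record prob (R : realType) (T : ptopologicalType) := Prob {
  prob_measure :> probability (borel T) R;
  prob_normal : forall A : set (borel T),
    ~ measurable A -> prob_measure A = 0%E }.

HB.instance Definition _ (R : realType) (T : ptopologicalType) :=
  gen_eqMixin (prob R T).
HB.instance Definition _ (R : realType) (T : ptopologicalType) :=
  gen_choiceMixin (prob R T).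

Section normalize.
Local Open Scope ereal_scope.
Context (R : realType) (T : ptopologicalType) (mu : probability (borel T) R).

Definition normal_measure (A : set (borel T)) : \bar R :=
  if `[< measurable A >] then mu A else 0.

Lemma normal_measureE A : measurable A -> normal_measure A = mu A.
Proof. by move=> mA; rewrite /normal_measure asboolT. Qed.

Let normal_measure0 : normal_measure set0 = 0.
Proof. by rewrite normal_measureE ?measure0. Qed.

Let normal_measure_ge0 A : 0 <= normal_measure A.
Proof. by rewrite /normal_measure; case: ifP. Qed.

Let normal_measure_sigma_additive : semi_sigma_additive normal_measure.
Proof.
move=> F mF tF mUF; rewrite normal_measureE //.
under eq_fun do under eq_bigr do rewrite normal_measureE //.
exact: measure_semi_sigma_additive.
Qed.

HB.instance Definition _ := isMeasure.Build _ _ _ normal_measure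
  normal_measure0 normal_measure_ge0 normal_measure_sigma_additive.

Let normal_measureT : normal_measure setT = 1.
Proof. by rewrite normal_measureE ?probability_setT. Qed.

HB.instance Definition _ :=
  Measure_isProbability.Build _ _ _ normal_measure normal_measureT.

Lemma normal_measure_normal (A : set (borel T)) :
  ~ measurable A -> (normal_measure : probability (borel T) R) A = 0.
Proof. by move=> nA; rewrite /= /normal_measure asboolF. Qed.

Definition normalize : prob R T := Prob normal_measure_normal.

Lemma normalizeE (A : set (borel T)) : measurable A -> normalize A = mu A.
Proof. exact: normal_measureE. Qed.

End normalize.

Lemma probability_ext d (T : measurableType d) (R : realType)
    (P Q : probability T R) :
  P =1 Q -> P = Q.
Proof.
case: P Q => [p pP] [q qP] /= /funext pq; case: _ / pq in qP *.
congr Probability.Pack.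
case: pP qP => [[a1 a2] [b] [c] [d0] [e] [f] [g]].
move=> [[a1' a2'] [b'] [c'] [d0'] [e'] [f'] [g']].
rewrite (Prop_irrelevance a1 a1') in b *.
rewrite (Prop_irrelevance a2 a2') in b *.
rewrite (Prop_irrelevance b b') (Prop_irrelevance c c').
rewrite (Prop_irrelevance d0 d0') (Prop_irrelevance e e').
by rewrite (Prop_irrelevance f f') (Prop_irrelevance g g').
Qed.

Lemma prob_eqP (R : realType) (T : ptopologicalType) (P Q : prob R T) :
  (forall A : set (borel T), measurable A -> P A = Q A) -> P = Q.
Proof.
move=> PQ; have {PQ} : P =1 Q.
  by move=> A; have [/PQ//|nA] := pselect (measurable A); rewrite !prob_normal.
case: P Q => [P Pn] [Q Qn] /= /probability_ext PQ; case: _ / PQ in Qn *.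
by congr Prob; exact: Prop_irrelevance.
Qed.

HB.instance Definition _ (R : realType) (T : ptopologicalType) :=
  isPointed.Build (prob R T) (normalize point).

Lemma i01_ge0 (R : realType) (t : {i01 R}) : 0 <= t%:num.
Proof. by []. Qed.

Lemma i01_onem_ge0 (R : realType) (t : {i01 R}) : 0 <= 1 - t%:num.
Proof. by rewrite subr_ge0. Qed.

Section mixture.
Local Open Scope ereal_scope.
Context (R : realType) (T : ptopologicalType).
Context (t : {i01 R}) (P Q : prob R T).

Let wP : {nonneg R} := NngNum (i01_ge0 t).
Let wQ : {nonneg R} := NngNum (i01_onem_ge0 t).

Definition mixture_measure : set (borel T) -> \bar R :=
  measure_add (mscale wP P) (mscale wQ Q).

HB.instance Definition _ := Measure.on mixture_measure.

Let mixture_measureT : mixture_measure setT = 1.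
Proof.
rewrite /mixture_measure measure_addE.
change ((t%:num)%:E * P setT + (1 - t%:num)%:E * Q setT = 1).
by rewrite !probability_setT !mule1 -EFinD addrC subrK.
Qed.

HB.instance Definition _ :=
  Measure_isProbability.Build _ _ _ mixture_measure mixture_measureT.

Definition mixture : prob R T := normalize mixture_measure.

Lemma mixtureE (A : set (borel T)) : measurable A ->
  mixture A = (t%:num)%:E * P A + (1 - t%:num)%:E * Q A.
Proof. by move=> mA; rewrite normalizeE //; exact: measure_addE. Qed.

End mixture.

Definition convex_prob (R : realType) (T : ptopologicalType)
    (C : set (prob R T)) : Prop :=
  forall (t : {i01 R}) P Q, C P -> C Q -> C (mixture t P Q).

Definition Cb (R : realType) (T : topologicalType) : Type :=
  {f : T -> R | continuous f /\ exists M, forall x, `|f x| <= M}.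

Definition prob_int (R : realType) (T : ptopologicalType) (P : prob R T)
  : {ptws Cb R T -> R} := fun f => (\int[P]_x sval f x)%R.

HB.instance Definition _ (R : realType) (T : ptopologicalType) :=
  Topological.copy (prob R T) (initial_topology (@prob_int R T)).

Definition half_line (R : realType) : set R := [set t | 0 <= t].
Arguments half_line : clear implicits.

Definition time (R : realType) : Type := half_line R.
HB.instance Definition _ (R : realType) := Topological.on (time R).

Lemma time0_subproof (R : realType) : (0 : R) \in half_line R.
Proof. exact/mem_set/lexx. Qed.

Definition time0 (R : realType) : time R :=
  exist (fun t => t \in half_line R) _ (time0_subproof R).

Lemma time_add_subproof (R : realType) (s t : time R) :
  set_val s + set_val t \in half_line R.
Proof.
case: s t => [s s0] [t t0]; apply/mem_set.
exact: addr_ge0 (set_mem s0) (set_mem t0).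
Qed.

Definition time_add (R : realType) (s t : time R) : time R :=
  exist (fun t => t \in half_line R) _ (time_add_subproof s t).

Lemma time_add_continuous (R : realType) (s : time R) :
  continuous (time_add s).
Proof.
move=> t A [_ [[B oB <-] Bt BA]].
have vc : continuous (set_val : time R -> R).
  exact: (@initial_continuous _ R (@set_val R (half_line R))).
have sc : (fun t => set_val s + set_val t) @ t --> set_val s + set_val t.
  apply: (continuous_comp (vc t)); apply: cvgD; first exact: cvg_cst.
  exact: cvg_id.
have : nbhs t [set t' | B (set_val s + set_val t')].
  by apply: (sc B); exact: open_nbhs_nbhs.
by apply: filterS => t' Bt'; exact: BA.
Qed.

Definition path_space (R : realType) (X : topologicalType) : Type :=
  continuousType (time R) X.

HB.instance Definition _ (R : realType) (X : topologicalType) :=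
  Topological.copy (path_space R X)
    (initial_topology
      (fun w : continuousType (time R) X => (w : {compact-open, time R -> X}))).

HB.instance Definition _ (R : realType) (X : ptopologicalType) :=
  isPointed.Build (path_space R X)
    (mkcts (fun t : time R => @cst_continuous (time R) X point t)).

Definition shift (R : realType) (X : topologicalType) (s : time R)
    (w : path_space R X) : path_space R X :=
  w \o mkcts (@time_add_continuous R s).

Lemma shiftE (R : realType) (X : topologicalType) (s t : time R)
    (w : path_space R X) :
  shift s w t = w (time_add s t).
Proof. by []. Qed.

Lemma shift_continuous (R : realType) (X : topologicalType) (s : time R) :
  continuous (@shift R X s).
Proof.
move=> w; pose i (w' : path_space R X) : {compact-open, time R -> X} := w'.
suff si : (i \o shift s) @ w --> i (shift s w).
  move=> A [_ [[B oB <-] Bw BA]].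
  have : nbhs w [set w' | B (i (shift s w'))].
    by apply: (si B); exact: open_nbhs_nbhs.
  by apply: filterS => w' Bw'; exact: BA.
have FF : Filter ((i \o shift s) @ w) by apply: fmap_filter; exact: nbhs_filter.
apply/compact_open_cvgP => K O cK oO KO.
pose K' := time_add s @` K.
have cK' : compact K'.
  apply: continuous_compact cK.
  exact/continuous_subspaceT/time_add_continuous.
have oK' := compact_open_open cK' oO.
have : nbhs w (i @^-1` [set g | g @` K' `<=` O]).
  apply: open_nbhs_nbhs; split; first by exists [set g | g @` K' `<=` O].
  by move=> _ [_ [t Kt <-] <-]; apply: KO; exists t.
apply: filterS => w' /= w'K _ [t Kt <-]; apply: w'K.
by exists (time_add s t) => //; exists t.
Qed.

Lemma shift_measurable (R : realType) (X : ptopologicalType) (s : time R) :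
  measurable_fun [set: borel (path_space R X)]
    (@shift R X s : borel (path_space R X) -> borel (path_space R X)).
Proof. apply: continuous_borel; exact: shift_continuous. Qed.

Definition borel_shift (R : realType) (X : ptopologicalType) (s : time R) :
  borel (path_space R X) -> borel (path_space R X) := @shift R X s.

HB.instance Definition _ (R : realType) (X : ptopologicalType) (s : time R) :=
  isMeasurableFun.Build _ _ _ _ (@borel_shift R X s) (@shift_measurable R X s).

Definition shift_law (R : realType) (X : ptopologicalType) (s : time R)
    (P : prob R (path_space R X)) : prob R (path_space R X) :=
  normalize (distribution P (@borel_shift R X s)).

Lemma shift_lawE (R : realType) (X : ptopologicalType) (s : time R)
    (P : prob R (path_space R X)) (B : set (borel (path_space R X))) :
  measurable B -> shift_law s P B = P (@shift R X s @^-1` B).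
Proof. exact: normalizeE. Qed.

Section filtration.
Context (R : realType) (X : ptopologicalType) (s : time R).

Definition past_cylinder : set (set (path_space R X)) :=
  [set A | exists2 r : time R, set_val r <= set_val s &
    exists2 B : set (borel X), measurable B &
      A = [set w : path_space R X | B (w r)]].

Definition past : measurableType past_cylinder.-sigma :=
  g_sigma_algebraType past_cylinder.

Definition past_as (P : prob R (path_space R X))
    (E : path_space R X -> Prop) : Prop :=
  exists N : set past, [/\ measurable N, P N = 0%E & forall w, ~ N w -> E w].

(* [k] is a version of the regular conditional probability distribution of P
   given the past up to s.  For X Polish a version exists, and two versions
   agree outside a P-null set belonging to the past, so that "some version
   satisfies E almost surely" and "every version does" are equivalent. *)
Definition is_rcpd (P : prob R (path_space R X))
    (k : path_space R X -> prob R (path_space R X)) : Prop :=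
  (forall A : set (borel (path_space R X)), measurable A ->
     measurable_fun [set: past] ((fun w => k w A) : past -> \bar R)) /\
  (forall (A : set (borel (path_space R X))) (B : set past),
     measurable A -> measurable B ->
     P (A `&` B) = (\int[P]_(w in B) k w A)%E).

Definition past_measurable
    (Q : path_space R X -> prob R (path_space R X)) : Prop :=
  forall f : Cb R (path_space R X),
    measurable_fun [set: past] ((fun w => prob_int (Q w) f) : past -> R).

Definition is_concat (P : prob R (path_space R X))
    (Q : path_space R X -> prob R (path_space R X))
    (P' : prob R (path_space R X)) : Prop :=
  (forall A : set past, measurable A -> P' A = P A) /\
  (exists2 k, is_rcpd P' k &
    {ae P', forall w : borel (path_space R X), shift_law s (k w) = Q w}).

Lemma past_borel (A : set past) :
  measurable A -> measurable (A : set (borel (path_space R X))).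
Proof.
move: A; apply: smallest_sub; first exact: sigma_algebra_measurable.
move=> A [r _ [B mB ->]].
have cr : continuous (fun w : path_space R X => w r).
  move=> w O; rewrite nbhsE => -[U [oU Uw] UO].
  pose V : set {compact-open, time R -> X} := [set g | g @` [set r] `<=` U].
  have oV : open V by apply: compact_open_open => //; exact: compact_set1.
  have : nbhs w [set w' : path_space R X | V w'].
    apply: open_nbhs_nbhs; split; first by exists V.
    by move=> _ [_ -> <-].
  by apply: filterS => w' Vw'; apply: UO; apply: Vw'; exists r.
have := continuous_borel cr => /(_ measurableT B mB); rewrite setTI; exact.
Qed.

End filtration.

(* Main.v *)
(** Krylov's argument.  Maximize lexicographically over C(x) the functionals
    P |-> E_P int_0^oo e^{-(k+1)t} f(w_t) dt, for f in a countable family that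
    separates the measures on X and k a natural number.  The reward splits at
    time s into a function of the past and a discounted reward of the shifted
    path; hence, by concatenating with a measurable selection of maximizers, the
    conditional futures of a maximizer are almost surely maximizers from w(s).
    Two maximizers at x have the same Laplace averages, hence the same
    one-dimensional marginals; disintegrating at the successive times, they have
    the same finite-dimensional distributions.  So the maximizer is unique, it
    depends measurably on x, and the conditional future of P_x at time s can
    only be P_{w(s)}. *)

From HB Require Import structures.
Require Import Defs.
From mathcomp Require Import all_boot all_order all_algebra.
From mathcomp Require Import all_classical all_reals all_analysis.
From mathcomp Require Import measurable_realfun.
From mathcomp Require Import ring lra.
Import Order.TTheory GRing.Theory Num.Theory.
Import numFieldNormedType.Exports.
Local Open Scope classical_set_scope.
Local Open Scope ring_scope.

Set Implicit Arguments.
Unset Strict Implicit.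
Unset Printing Implicit Defensive.

(** * Countable families of continuous functions separating measures *)

(** The comparison at time s needs a measurable choice of maximizers before maximizers are known to
    be unique, and uniqueness itself rests on that comparison. The circle is broken by a second
    lexicographic maximization, inside the set of maximizers, over functionals on path space that
    separate measures outright; these have no time structure and serve only to single out one
    measurable [Q]. Hypothesis (C2) speaks of the points x whose set of laws meets a closed set, so
    every maximization has to be expressed by such hits. Exponential weights are used because a
    shift by s multiplies them by a constant: the discount of the future does not depend on the
    path. All rates k + 1 occur because, in the variable exp(-t), combinations of the weights are
    polynomials, and a polynomial kernel can concentrate at a prescribed time. Measurability on path
    space is reduced throughout to countable families: balls centred on a dense sequence and
    rational times. *)

Lemma borel_continuous_measurable (R : realType) (T : ptopologicalType)
    (f : T -> R) :
  continuous f -> measurable_fun [set: borel T] (f : borel T -> R).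
Proof.
move=> cf; apply: measurability (RGenOpens.measurableE R) _.
move=> _ [_ [a [b ->]] <-]; rewrite setTI; apply: sub_sigma_algebra.
by have /continuousP := cf; apply; exact: interval_open.
Qed.

Section separation.
Context {R : realType} {T : ptopologicalType} {I : eqType} (h : I -> T -> R).
Hypothesis h_cont : forall i, continuous (h i).
Hypothesis h_ge0 : forall i x, 0 <= h i x.
Hypothesis h_gen : @open T `<=` <<s range (fun i => [set x | 0 < h i x]) >>.

(** As the first component grows this increases to the indicator of the set where all the listed
    [h i] are positive. Products over lists are taken because such sets form a pi-system. *)
Definition spike (p : nat * seq I) (x : T) : R :=
  \prod_(i <- p.2) Num.min 1 (p.1%:R * h i x).

Definition spike_supp (l : seq I) : set (borel T) :=
  [set x | forall i, i \in l -> 0 < h i x].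

Lemma spike_ge0 p x : 0 <= spike p x.
Proof. by apply: prodr_ge0 => i _; rewrite le_min ler01 mulr_ge0. Qed.

Lemma spike_le1 p x : spike p x <= 1.
Proof.
apply: prodr_ile1 => i _.
by rewrite le_min ler01 mulr_ge0//= ge_min lexx.
Qed.

Lemma spike_cons n i l x : 
  spike (n, i :: l) x = Num.min 1 (n%:R * h i x) * spike (n, l) x.
Proof. by rewrite /spike big_cons. Qed.

Lemma spike_nil n x : spike (n, [::]) x = 1.
Proof. by rewrite /spike big_nil. Qed.

Lemma spike_continuous p : continuous (spike p).
Proof.
case: p => n l x; elim: l => [|i l IH].
  have -> : spike (n, [::]) = cst 1 by apply/funext => ?; rewrite spike_nil.
  exact: cvg_cst.
have -> : spike (n, i :: l) = (fun x => Num.min 1 (n%:R * h i x) * spike (n, l) x).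
  by apply/funext => ?; rewrite spike_cons.
apply: cvgM; last exact: IH.
apply: (@continuous_min R T (cst 1) (fun x => n%:R * h i x)).
  exact: cvg_cst.
by apply: cvgM; [exact: cvg_cst | exact: h_cont].
Qed.

Lemma spike_bounded p : exists M, forall x, `|spike p x| <= M.
Proof. by exists 1 => x; rewrite ger0_norm ?spike_ge0 ?spike_le1. Qed.

Definition spike_Cb p : Cb R T :=
  exist _ (spike p) (conj (@spike_continuous p) (spike_bounded p)).

Lemma spike_nd l x : {homo (fun n => spike (n, l) x) : m n / (m <= n)%N >-> m <= n}.
Proof.
move=> m n mn; rewrite /spike/=; elim: l => [|i l IH]; first by rewrite !big_nil.
rewrite !big_cons ler_pM ?prodr_ge0// => *; rewrite ?le_min ?ler01 ?mulr_ge0//.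
by rewrite ge_min lexx/= ge_min ler_wpM2r ?ler_nat ?orbT.
Qed.

Lemma spike_cvg l x : spike (n, l) x @[n --> \oo] --> (\1_(spike_supp l) x : R).
Proof.
elim: l => [|i l IH].
  under eq_fun do rewrite spike_nil.
  by rewrite indicE mem_set//; exact: cvg_cst.
have -> : \1_(spike_supp (i :: l)) x = (0 < h i x)%R%:R * \1_(spike_supp l) x :> R.
  rewrite !indicE; case: (boolP (_ < _)) => hi.
    rewrite mul1r; congr (_%:R); congr nat_of_bool; apply/idP/idP.
      by move=> /set_mem H; apply/mem_set => j jl; apply: H; rewrite inE jl orbT.
    move=> /set_mem H; apply/mem_set => j; rewrite inE => /predU1P[->//|]; exact: H.
  rewrite mul0r memNset//= => /(_ i); rewrite inE eqxx => /(_ isT).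
  by rewrite (negPf hi).
under eq_fun do rewrite spike_cons.
apply: cvgM; last exact: IH.
have [hi0|hi0] := ltP 0 (h i x) => /=; last first.
  have -> : h i x = 0 by apply/eqP; rewrite eq_le hi0 h_ge0.
  under eq_fun do rewrite mulr0 min_r//; exact: cvg_cst.
(* Once n exceeds the inverse of [h i x] the new factor is exactly 1. *)
apply: cvg_near_cst; near=> n; rewrite min_l// -ler_pdivrMr// mul1r.
near: n; exact: nbhs_infty_ger.
Unshelve. all: by end_near. Qed.

Lemma borel_generated :
  @measurable _ (borel T) = <<s range spike_supp >>.
Proof.
apply/seteqP; split.
  apply: smallest_sub; first exact: smallest_sigma_algebra.
  move=> O /h_gen; apply: smallest_sub; first exact: smallest_sigma_algebra.
  move=> _ [i _ <-]; apply: sub_sigma_algebra; exists [:: i] => //.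
  apply/seteqP; split => x /=; first by apply; rewrite inE.
  by move=> ? j; rewrite inE => /eqP ->.
apply: smallest_sub; first exact: sigma_algebra_measurable.
move=> _ [l _ <-]; elim: l => [|i l IH].
  rewrite [X in measurable X](_ : _ = setT)//.
  by apply/seteqP; split.
rewrite [X in measurable X](_ : _ = [set x | 0 < h i x] `&` spike_supp l).
  apply: measurableI => //; apply: sub_sigma_algebra.
  have /continuousP := @h_cont i => /(_ [set y | 0 < y]); apply.
  exact: open_gt.
apply/seteqP; split => x /=.
  move=> H; split; first by apply: H; rewrite inE eqxx.
  by move=> j jl; apply: H; rewrite inE jl orbT.
by move=> [? H] j; rewrite inE => /predU1P[->|/H].
Qed.

Lemma spike_supp_setI : setI_closed (range spike_supp).
Proof.
move=> _ _ [l _ <-] [l' _ <-]; exists (l ++ l') => //.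
apply/seteqP; split => x /=.
  by move=> H; split => i il; apply: H; rewrite mem_cat il ?orbT.
by move=> [H H'] i; rewrite mem_cat => /orP[/H|/H'].
Qed.

Lemma measurable_spike_supp l : measurable (spike_supp l).
Proof. by rewrite borel_generated; apply: sub_sigma_algebra; exists l. Qed.

Lemma spike_int_cvg (P : {measure set (borel T) -> \bar R}) l :
  (\int[P]_x (spike (n, l) x)%:E)%E @[n --> \oo] --> P (spike_supp l).
Proof.
have mb n : measurable_fun [set: borel T] (fun x => (spike (n, l) x)%:E).
  apply/measurable_EFinP; apply: (@borel_continuous_measurable R T).
  exact: (@spike_continuous (n, l)).
have -> : P (spike_supp l) =
    (\int[P]_(x in [set: borel T]) limn (fun n => (spike (n, l) x)%:E))%E.
  rewrite -[in LHS](setIT (spike_supp l)) -integral_indic//; last first.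
    exact: measurable_spike_supp.
  apply: eq_integral => x _; apply/esym/cvg_lim => //.
  apply/cvg_EFin; first exact: nearW.
  exact: spike_cvg.
apply: cvg_monotone_convergence => //.
  by move=> n x _; rewrite lee_fin spike_ge0.
by move=> x _ m n mn; rewrite lee_fin spike_nd.
Qed.

(** Monotone convergence carries equality from the spikes to the sets [spike_supp], a pi-system
    generating the Borel sets. *)
Lemma spike_measure_unique (P Q : {measure set (borel T) -> \bar R}) :
  P setT = Q setT -> (P setT < +oo)%E ->
  (forall p, \int[P]_x (spike p x)%:E = \int[Q]_x (spike p x)%:E)%E ->
  forall A, measurable A -> P A = Q A.
Proof.
move=> PQT PT PQ A mA.
apply: (measure_unique (range spike_supp) (fun=> setT)) => //.
- exact: borel_generated.
- exact: spike_supp_setI.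
(* The empty list imposes no condition, so the pi-system contains the whole space. *)
- by move=> _; exists [::] => //; apply/seteqP; split.
- by rewrite bigcup_const.
- move=> A0 [l _ <-]; have := @spike_int_cvg P l.
  have -> : (fun n => \int[P]_x (spike (n, l) x)%:E)%E =
    (fun n => \int[Q]_x (spike (n, l) x)%:E)%E by apply/funext => n; exact: PQ.
  by move=> cP; apply: (cvg_unique _ cP (@spike_int_cvg Q l)); exact: ereal_hausdorff.
Qed.

End separation.

(** * Tent functions on a separable metric space *)

Section metric_separation.
Context {R : realType} {X : ptopologicalType} (d : X -> X -> R).
Hypothesis d_metric : is_metric d.
Hypothesis d_nbhs : metrizes d.

Lemma metric_sym x y : d x y = d y x. Proof. by case: d_metric. Qed.

Lemma metric_tri x y z : d x z <= d x y + d y z. Proof. by case: d_metric. Qed.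

Lemma metric_xx x : d x x = 0. Proof. by case: d_metric => H _ _; apply/H. Qed.

Lemma metric_continuousl a : continuous (d ^~ a).
Proof.
move=> x; apply/cvgrPdist_lt => e e0; apply/(d_nbhs x); exists e => // y /= xy.
rewrite ltr_norml; have := metric_tri y x a; have := metric_tri x y a.
by rewrite (metric_sym y x); move=> ? ?; apply/andP; split; lra.
Qed.

Lemma metric_closed1 (x : X) : closed [set x].
Proof.
have -> : [set x] = (d ^~ x) @^-1` [set (0 : R)].
  by apply/seteqP; split => y /=; case: d_metric => H _ _ /H.
apply: closed_comp; last exact: closed_eq.
by move=> ? _; exact: metric_continuousl.
Qed.

Variable e : nat -> X.
Hypothesis e_dense : dense (range e).

Definition hat (i : nat * nat) (x : X) : R := Num.max 0 (i.2.+1%:R^-1 - d x (e i.1)).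

Lemma hat_ge0 i x : 0 <= hat i x. Proof. by rewrite le_max lexx. Qed.

Lemma hat_gt0 i x : (0 < hat i x) = (d x (e i.1) < i.2.+1%:R^-1).
Proof. by rewrite lt_max ltxx/= subr_gt0. Qed.

Lemma hat_continuous i : continuous (hat i).
Proof.
move=> x; apply: (@continuous_max R X (cst 0) (fun x => i.2.+1%:R^-1 - d x (e i.1))).
  exact: cvg_cst.
by apply: cvgB; [exact: cvg_cst | exact: metric_continuousl].
Qed.

(** The closed ball is placed inside [U] because tubes of paths are cut out by weak inequalities. *)
Lemma ball_basis x U : nbhs x U -> exists i, 0 < hat i x /\
  [set y | d y (e i.1) <= i.2.+1%:R^-1] `<=` U.
Proof.
move=> /d_nbhs [r r0 rU].
have [m mr] : exists m, m.+1%:R^-1 < r / 2.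
  have := @near_infty_natSinv_lt R (PosNum (divr_gt0 r0 (ltr0n _ 2))).
  by move=> [m _ /(_ m (leqnn m))] /=; exists m.
(* Density speaks of open sets, while [metrizes] only makes the ball a neighbourhood; hence the
   interior. *)
have : (interior [set y | d x y < m.+1%:R^-1]) `&` range e !=set0.
  apply: e_dense; last exact: open_interior.
  by exists x; apply/d_nbhs; exists m.+1%:R^-1.
move=> [z0 [/interior_subset/= xz [n _ nE]]].
have {xz nE} xy : d x (e n) < m.+1%:R^-1 by rewrite nE.
exists (n, m); rewrite hat_gt0; split => // z /= zn; apply: rU => /=.
apply: le_lt_trans (metric_tri x (e n) z) _; rewrite (splitr r).
by rewrite (metric_sym (e n)) ltrD ?(le_lt_trans zn)// (lt_trans xy).
Qed.

Lemma hat_generates : @open X `<=` <<s range (fun i => [set x | 0 < hat i x]) >>.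
Proof.
move=> O oO.
rewrite (_ : O = \bigcup_(i in [set i | [set x | 0 < hat i x] `<=` O])
    [set x | 0 < hat i x]).
  rewrite bigcup_mkcond.
  apply: (@countable_bigcupT_measurable _ (g_sigma_algebraType _)).
    exact: countableP.
  move=> i; case: ifP => _; last exact: measurable0.
  by apply: sub_sigma_algebra; exists i.
apply/seteqP; split => [x Ox|x [i iO /iO]//].
have [i [ix iO]] := ball_basis (open_nbhs_nbhs (conj oO Ox)).
exists i => // y /=; rewrite hat_gt0 => /ltW; exact: iO.
Qed.
End metric_separation.

(** * The Borel sigma-algebra of path space *)

Section clock.
Context {R : realType}.

Lemma clamp_subproof (t : R) : Num.max 0 t \in half_line R.
Proof. by apply/mem_set; rewrite /half_line/= le_max lexx. Qed.

(* Lets Lebesgue integrals over [R] see a path, whose times form a subtype. *)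
Definition clamp (t : R) : time R :=
  exist (fun t => t \in half_line R) _ (clamp_subproof t).

Lemma time_ge0 (t : time R) : 0 <= set_val t.
Proof. by case: t => t ht; exact: (set_mem ht). Qed.

Lemma time_inj (s t : time R) : set_val s = set_val t -> s = t.
Proof.
case: s t => [s hs] [t ht] st; have {}st : s = t by [].
by case: _ / st in ht *; congr exist; exact: Prop_irrelevance.
Qed.

Lemma clampE (t : R) : 0 <= t -> set_val (clamp t) = t.
Proof. by move=> t0; rewrite /set_val/=; exact: max_r. Qed.

Lemma clamp_val (t : time R) : clamp (set_val t) = t.
Proof. by apply: time_inj; rewrite clampE// time_ge0. Qed.

Lemma val_continuous : continuous (set_val : time R -> R).
Proof. exact: (@initial_continuous _ R (@set_val R (half_line R))). Qed.

Lemma val_cvg {U : Type} (F : set_system U) (f : U -> time R) t : Filter F ->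
  set_val (f x) @[x --> F] --> set_val t -> f x @[x --> F] --> t.
Proof.
move=> FF cf A [_ [[B oB <-] Bt BA]].
have FB : F [set x | B (set_val (f x))] by apply: cf; exact: open_nbhs_nbhs.
change (F (f @^-1` A)); apply: filterS FB => x Bx; exact: (BA (f x)).
Qed.

Lemma clamp_continuous : continuous clamp.
Proof.
move=> t; apply: val_cvg.
apply: (@continuous_max R R (cst 0) id); [exact: cvg_cst | exact: cvg_id].
Qed.

(** The nonnegative rationals, a countable dense set of times. *)
Definition tick (c : nat * nat) : time R := clamp (c.1%:R / c.2.+1%:R).

Lemma tick_dense (t : R) (e : R) : 0 <= t -> 0 < e -> exists c, `|t - set_val (tick c)| < e.
Proof.
move=> t0 e0.
have [m _ /(_ m (leqnn m))/= me] := @near_infty_natSinv_lt R (PosNum e0).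
(* The multiple of 1/(m+1) just below t. *)
exists (Num.truncn (t * m.+1%:R), m).
rewrite clampE ?divr_ge0//=.
have m0 : (0 : R) < m.+1%:R by [].
have /andP[h1 h2] := truncn_itv (mulr_ge0 t0 (ltW m0)).
apply: le_lt_trans me; rewrite ger0_norm; last by rewrite subr_ge0 ler_pdivrMr.
rewrite lerBlDr -[leLHS](mulfK (lt0r_neq0 m0)) -[X in _ <= X + _]mul1r -mulrDl.
by rewrite ler_pM2r ?invr_gt0// addrC natr1; exact: ltW.
Qed.

End clock.

Lemma time_nbhs_ball {R : realType} (t : time R) (A : set (time R)) : nbhs t A ->
  exists2 r, 0 < r & forall t', `|set_val t - set_val t'| < r -> A t'.
Proof.
move=> [_ [[B oB <-] Bt BA]].
have /nbhs_ballP[r r0 rB] : nbhs (set_val t) B by exact: open_nbhs_nbhs.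
by exists r => // t' tt'; apply: BA; exact: rB.
Qed.

Lemma near_time_ball {R : realType} (t : time R) (a r : R) : `|set_val t - a| < r ->
  \forall t' \near t, `|set_val t' - a| < r.
Proof.
move=> ta.
have c : {for t, continuous ((fun y : R => `|y - a|) \o (set_val : time R -> R))}.
  apply: continuous_comp; first exact: val_continuous.
  by apply: cvg_norm; apply: cvgB; [exact: cvg_id | exact: cvg_cst].
by apply: (c [set y | y < r]); exact: lt_nbhsl.
Qed.

(** * Countable generation of the Borel sets of path space *)

Section path_borel.
Context {R : realType} {X : ptopologicalType} (d : X -> X -> R).
Hypothesis d_metric : is_metric d.
Hypothesis d_nbhs : metrizes d.
Variable e : nat -> X.
Hypothesis e_dense : dense (range e).
Notation path := (path_space R X).

Lemma path_eval_continuous (t : time R) : continuous (fun w : path => w t).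
Proof.
move=> w O; rewrite nbhsE => -[U [oU Uw] UO].
pose V : set {compact-open, time R -> X} := [set g | g @` [set t] `<=` U].
have oV : open V by apply: compact_open_open => //; exact: compact_set1.
have : nbhs w [set w' : path | V w'].
  by apply: open_nbhs_nbhs; split; [exists V | move=> _ [_ -> <-]].
by apply: filterS => w' Vw'; apply: UO; apply: Vw'; exists t.
Qed.

Lemma path_continuous (w : path) : continuous w.
Proof. exact: cts_fun. Qed.

Definition path_hat (i : (nat * nat) * (nat * nat)) (w : path) : R :=
  hat d e i.2 (w (tick i.1)).

Lemma path_hat_ge0 i w : 0 <= path_hat i w.
Proof. exact: hat_ge0. Qed.

Lemma path_hat_continuous i : continuous (path_hat i).
Proof.
move=> w; apply: (@continuous_comp path X R (fun w => w (tick i.1)) (hat d e i.2)).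
  exact: path_eval_continuous.
exact: hat_continuous.
Qed.

(** The inequality on times is strict and the one on distances is weak: by continuity the constraint
    at the rational times of the window then implies it on the whole window. *)
Definition tube (j : (nat * nat) * nat * (nat * nat)) : set path :=
  [set w | forall t : time R, `|set_val t - set_val (tick j.1.1)| < j.1.2.+1%:R^-1 ->
     d (w t) (e j.2.1) <= j.2.2.+1%:R^-1].

Definition tubes (l : seq ((nat * nat) * nat * (nat * nat))) : set path :=
  [set w | forall j, j \in l -> tube j w].

(** Comparing this filter with the neighbourhoods of [w] replaces an explicit choice of finite
    covers. Only one comparison is made: tubes through [w] need not be neighbourhoods of [w]. *)
Let near_path (w : path) : set_system path :=
  filter_from [set l | tubes l w] tubes.

Let near_path_filter w : Filter (near_path w).
Proof.
apply: filter_from_filter; first by exists [::].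
move=> l l' lw lw'; exists (l ++ l') => /=.
  by move=> j; rewrite mem_cat => /orP[/lw|/lw'].
by move=> w' lw''; split => j jl; apply: lw''; rewrite mem_cat jl ?orbT.
Qed.

(** Around each time of a compact [K] some tube through [w] forces its paths into [O]; compactness
    of [K], in its near-covering form, makes finitely many tubes suffice. *)
Let near_path_cvg (w : path) A : nbhs w A -> near_path w A.
Proof.
move=> [_ [[B oB <-] Bw BA]].
have FF := near_path_filter w.
suff wcvg : (fun w' : path => (w' : {compact-open, time R -> X})) @ near_path w
    --> (w : {compact-open, time R -> X}).
  have FB : near_path w [set w' | B w'].
    by apply: (wcvg B); exact: open_nbhs_nbhs.
  by apply: filterS FB => w' Bw'; exact: BA.
apply/compact_open_cvgP => K O /compact_near_coveringP cK oO wKO.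
have FK : near_path w [set w' : path | K `<=` (fun t => O (w' t))].
  apply: (cK _ (near_path w) (fun (w' : path) t => O (w' t))) => t Kt.
  have [i [it iO]] : exists i, 0 < hat d e i (w t) /\
      [set y | d y (e i.1) <= i.2.+1%:R^-1] `<=` O.
    apply: ball_basis => //; apply: open_nbhs_nbhs; split => //.
    by apply: wKO; exists t.
  have [r r0 rt] : exists2 r, 0 < r &
      forall t', `|set_val t - set_val t'| < r -> 0 < hat d e i (w t').
    apply: time_nbhs_ball.
    have c : (fun t' => hat d e i (w t')) @ t --> hat d e i (w t).
      apply: (@continuous_comp (time R) X R w (hat d e i)).
        exact: path_continuous.
      exact: hat_continuous.
    by apply: (c [set y | 0 < y]); exact: lt_nbhsr.
  (* With 1/(m+1) below r/2, the window of that radius around a rational close to t contains t and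
     stays within r of it. *)
  have [m _ /(_ m (leqnn m))/= mr] :=
    @near_infty_natSinv_lt R (PosNum (divr_gt0 r0 (ltr0n _ 2))).
  have m0 : 0 < m.+1%:R^-1 :> R by rewrite invr_gt0.
  have [c tc] := tick_dense (time_ge0 t) m0.
  exists ([set t' | `|set_val t' - set_val (tick c)| < m.+1%:R^-1],
          tubes [:: (c, m, i)]).
    split; first exact: near_time_ball.
    exists [:: (c, m, i)] => // j; rewrite inE => /eqP -> t' /= t'c.
    suff : 0 < hat d e i (w t') by rewrite hat_gt0 => /ltW.
    apply: rt.
    rewrite (splitr r) -(subrK (set_val (tick c)) (set_val t)) -addrA.
    apply: le_lt_trans (ler_normD _ _) _; rewrite ltrD ?(lt_trans tc)//.
    by rewrite distrC (lt_trans t'c).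
  move=> [t' w'] /= [t'c w'c]; apply: iO => /=.
  by have /(_ t' t'c) := w'c _ (mem_head _ _).
have sub : [set w' : path | K `<=` (fun t => O (w' t))] `<=`
    [set w' : path | (w' : time R -> X) @` K `<=` O].
  by move=> w' Kw' _ [t Kt <-]; exact: Kw'.
exact: filterS sub FK.
Qed.

Lemma tubes_basis (w : path) O : open O -> O w ->
  exists2 l, tubes l w & tubes l `<=` O.
Proof. by move=> oO Ow; apply: near_path_cvg; exact: open_nbhs_nbhs. Qed.

(** There are countably many finite lists of tubes, so an open set is a countable union of sets
    [tubes l]; each tube is a countable intersection of constraints at rational times. *)
Lemma path_hat_generates :
  @open path `<=` <<s range (fun i => [set w | 0 < path_hat i w]) >>.
Proof.
set G := range _; pose S := g_sigma_algebraType G.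
have evm c (B : set (borel X)) : measurable B ->
    measurable ([set w : path | B (w (tick c))] : set S).
  have mev : measurable_fun [set: S] (fun w : S => (w : path) (tick c) : borel X).
    apply: (@measurability _ _ S (borel X) setT _
      (range (fun i => [set x | 0 < hat d e i x]))).
      apply/seteqP; split.
        apply: smallest_sub; first exact: smallest_sigma_algebra.
        exact: hat_generates.
      apply: smallest_sub; first exact: sigma_algebra_measurable.
      move=> _ [i _ <-]; apply: sub_sigma_algebra.
      have /continuousP := @hat_continuous _ _ _ d_metric d_nbhs e i.
      by move=> /(_ [set y | 0 < y]); apply; exact: open_gt.
    move=> _ [_ [i _ <-] <-]; rewrite setTI; apply: sub_sigma_algebra.
    by exists (c, i).
  by move=> mB; have := mev measurableT B mB; rewrite setTI.
have tubem j : measurable (tube j : set S).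
  rewrite (_ : tube j = \bigcap_(c in [set c |
      `|set_val (tick c) - set_val (tick j.1.1)| < j.1.2.+1%:R^-1 :> R])
      [set w : path | d (w (tick c)) (e j.2.1) <= j.2.2.+1%:R^-1]).
    rewrite -[X in measurable X]setCK setC_bigcap; apply: measurableC.
    rewrite bigcup_mkcond.
    apply: countable_bigcupT_measurable; first exact: countableP.
    move=> c; case: ifP => _ //; apply: measurableC.
    apply: (evm c [set x | d x (e j.2.1) <= j.2.2.+1%:R^-1]).
    rewrite -[X in measurable X]setCK; apply: measurableC.
    apply: sub_sigma_algebra; rewrite openC.
    apply: (@closed_comp _ _ (d ^~ (e j.2.1)) [set y | y <= j.2.2.+1%:R^-1]).
      by move=> ? _; exact: metric_continuousl.
    exact: closed_le.
  apply/seteqP; split => w /= wj; first by move=> c /= cj; exact: wj.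
  (* A violation at a real time persists nearby, hence at a rational time of the same window. *)
  move=> t tj; rewrite leNgt; apply/negP => jt.
  have c : (fun t' => d (w t') (e j.2.1)) @ t --> d (w t) (e j.2.1).
    apply: (@continuous_comp (time R) X R w (d ^~ (e j.2.1))).
      exact: path_continuous.
    exact: metric_continuousl.
  have {c} : nbhs t [set t' | j.2.2.+1%:R^-1 < d (w t') (e j.2.1)].
    by apply: (c [set y | j.2.2.+1%:R^-1 < y]); exact: lt_nbhsr.
  move=> /(filterI (near_time_ball tj)) /time_nbhs_ball[r r0 rt].
  have [c tc] := tick_dense (time_ge0 t) r0.
  have [/= cj] := rt _ tc; rewrite ltNge => /negP; apply; exact: wj.
have tubesm l : measurable (tubes l : set S).
  elim: l => [|j l IH].
    rewrite (_ : tubes [::] = setT) => [|]; first exact: measurableT.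
    by apply/seteqP; split.
  rewrite (_ : tubes (j :: l) = tube j `&` tubes l); first exact: measurableI.
  apply/seteqP; split => w /=.
    move=> H; split; first by apply: H; rewrite inE eqxx.
    by move=> i il; apply: H; rewrite inE il orbT.
  by move=> [? H] i; rewrite inE => /predU1P[->|/H].
move=> O oO.
rewrite (_ : O = \bigcup_(l in [set l | tubes l `<=` O]) tubes l).
  rewrite bigcup_mkcond.
  apply: (@countable_bigcupT_measurable _ S); first exact: countableP.
  by move=> l; case: ifP => _; [exact: tubesm | exact: measurable0].
apply/seteqP; split => [w Ow|w [l lO /lO]//].
by have [l lw lO] := tubes_basis oO Ow; exists l.
Qed.

End path_borel.

(** * Lexicographic maximization and measurable selection *)

Section lexicographic_argmax.
Context {R : realType} {T : topologicalType} (u : nat -> T -> R).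
Hypothesis u_cont : forall n, continuous (u n).

Fixpoint lex (C : set T) (n : nat) : set T :=
  if n is m.+1 then [set P | lex C m P /\ forall Q, lex C m Q -> u m Q <= u m P]
  else C.

Definition lexmax (C : set T) : set T := \bigcap_n lex C n.

Lemma lex_nonincr C m n : (m <= n)%N -> lex C n `<=` lex C m.
Proof.
elim: n => [|n IH]; first by rewrite leqn0 => /eqP ->.
rewrite leq_eqVlt => /predU1P[->//|]; rewrite ltnS => mn P /= [+ _].
exact: IH.
Qed.

Lemma lexmax_sub C : lexmax C `<=` C.
Proof. by move=> P /(_ 0%N Logic.I). Qed.

(** Closedness is stated relative to [C] since [T] is not assumed Hausdorff, so that a compact [C]
    might fail to be closed. *)
Lemma lex_closedI C n : compact C -> C !=set0 ->
  lex C n !=set0 /\ exists2 Z, closed Z & lex C n = C `&` Z.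
Proof.
move=> cC C0; elim: n => [|n [ne [Z cZ lexE]]].
  by split => //; exists setT; [exact: closedT | rewrite setIT].
have cl : compact (lex C n) by rewrite lexE; exact: compact_closedI.
have [c /set_mem lc cmax] :=
  compact_EVT_max ne cl (continuous_subspaceT (@u_cont n)).
split; first by exists c; split => // Q lQ; apply: cmax; exact/mem_set.
(* Within the stage, being a maximizer means reaching the level of one maximizer [c]. *)
exists (Z `&` [set P | u n c <= u n P]).
  apply: closedI => //; apply: (@closed_comp _ _ (u n) [set y | u n c <= y]).
    by move=> ? _; exact: u_cont.
  exact: closed_ge.
rewrite setIA -lexE; apply/seteqP; split => P /= [lP H]; split => //.
  exact: H.
by move=> Q lQ; apply: le_trans H; apply: cmax; exact/mem_set.
Qed.

Lemma lex_compact C n : compact C -> C !=set0 -> compact (lex C n).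
Proof.
by move=> cC C0; have [_ [Z cZ ->]] := lex_closedI n cC C0; exact: compact_closedI.
Qed.

(** Points of the successive stages lying in [K] have a cluster point, which lies in every stage
    because the stages decrease. This turns hitting [lexmax] into a countable conjunction. *)
Lemma lexmaxI C K : compact C -> C !=set0 -> closed K ->
  (lexmax C `&` K !=set0) <-> forall n, lex C n `&` K !=set0.
Proof.
move=> cC C0 cK; split => [[P [lP KP]] n|H]; first by exists P; split => //; exact: lP.
have [p lKp] := choice H.
have FF : ProperFilter (p @ \oo) by exact: fmap_proper_filter.
have [q [Cq qcl]] : C `&` cluster (p @ \oo) !=set0.
  apply: cC; exists 0%N => // n _; have [lp _] := lKp n.
  exact: (lex_nonincr (leq0n n)) lp.
have qin A : closed A -> (\forall n \near \oo, A (p n)) -> A q.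
  by move=> cA FA; apply: cA => B qB; exact: qcl.
exists q; split; last by apply: qin => //; apply: nearW => n; have [] := lKp n.
move=> n _; have [_ [Z cZ lexE]] := lex_closedI n cC C0.
rewrite lexE; split => //; apply: qin => //; exists n => // m /= nm.
have [lp _] := lKp m.
by have : lex C n (p m) := lex_nonincr nm lp; rewrite lexE => -[].
Qed.

Lemma lexmax_nonempty C : compact C -> C !=set0 -> lexmax C !=set0.
Proof.
move=> cC C0; have [_ H] := lexmaxI cC C0 closedT.
by rewrite -[lexmax C]setIT; apply: H => n; rewrite setIT; have [] := lex_closedI n cC C0.
Qed.

Lemma lexmax_compact C : compact C -> C !=set0 -> compact (lexmax C).
Proof.
move=> cC C0; have Zex n := (lex_closedI n cC C0).2.
have /choice[Z HZ] : forall n, exists Z, closed Z /\ lex C n = C `&` Z.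
  by move=> n; have [Z ? ?] := Zex n; exists Z.
rewrite (_ : lexmax C = C `&` \bigcap_n Z n).
  apply: compact_closedI => //; apply: closed_bigI => n _; exact: (HZ n).1.
apply/seteqP; split => [P lP|P [CP ZP] n _].
  split; first exact: lexmax_sub.
  by move=> n _; have := lP n Logic.I; rewrite (HZ n).2 => -[].
by rewrite (HZ n).2; split => //; exact: ZP.
Qed.

(** Membership in a stage depends, inside [C], only on the values of the functionals already
    maximized. *)
Lemma lex_eq C n P Q : lex C n P -> C Q ->
  (forall i, (i < n)%N -> u i Q = u i P) -> lex C n Q.
Proof.
elim: n => [//|n IH] [lP Pmax] CQ uQP; split.
  by apply: IH => // i ni; apply: uQP; rewrite ltnS ltnW.
by move=> Q' lQ'; rewrite uQP//; exact: Pmax.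
Qed.

Lemma lexmax_values C P Q n : lexmax C P -> lexmax C Q -> u n P = u n Q.
Proof.
move=> lP lQ; have [lPn Pmax] := lP n.+1 Logic.I.
by have [lQn Qmax] := lQ n.+1 Logic.I; apply/eqP; rewrite eq_le Pmax ?Qmax.
Qed.

Context {d : measure_display} {S : measurableType d} (C : S -> set T).
Hypothesis C_ne : forall x, C x !=set0.
Hypothesis C_compact : forall x, compact (C x).
Hypothesis C_meas : forall K, closed K -> measurable [set x | C x `&` K !=set0].

(** The maximum over the stage is attained in [K] exactly when every rational level reached by the
    stage is also reached inside [K]. Each clause asks whether the previous stage hits a closed set,
    so the induction hypothesis applies. *)
Lemma lex_measurable n K : closed K ->
  measurable [set x | lex (C x) n `&` K !=set0].
Proof.
elim: n K => [|n IH] K cK; first exact: C_meas.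
pose A q := [set x | lex (C x) n `&` [set P | ratr q <= u n P] !=set0].
pose B q := [set x | lex (C x) n `&` (K `&` [set P | ratr q <= u n P]) !=set0].
have cq (q : rat) : closed [set P | ratr q <= u n P].
  apply: (@closed_comp _ _ (u n) [set y | ratr q <= y]).
    by move=> ? _; exact: u_cont.
  exact: closed_ge.
rewrite (_ : mkset _ = ~` \bigcup_q (A q `\` B q)).
  apply/measurableC/bigcupT_measurable_rat => q; apply: measurableD.
    exact: IH.
  by apply: IH; exact: closedI.
apply/seteqP; split => [x [P [[lP Pmax] KP]] [q _ [[Q [lQ qQ]]]]|x H].
  by apply; exists P; split => //; split => //=; apply: le_trans qQ _; exact: Pmax.
have AB q : A q x -> B q x.
  by move=> Aq; apply: contrapT => Bq; apply: H; exists q.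
have cl : compact (lex (C x) n) by apply: lex_compact; [exact: C_compact|exact: C_ne].
have [ne _] := lex_closedI n (@C_compact x) (C_ne x).
have [c /set_mem lc cmax] :=
  compact_EVT_max ne cl (continuous_subspaceT (@u_cont n)).
have B_le q : ratr q < u n c -> B q x.
  by move=> qc; apply: AB; exists c; split => //=; exact: ltW.
have rat_lt (y z : R) : y < z -> exists2 q : rat, y < ratr q & ratr q < z.
  move=> yz; have [q qyz] := rat_in_itvoo yz.
  by move: qyz; rewrite in_itv/= => /andP[]; exists q.
(* A maximum over [K] needs a point of [K]: any rational level below [u n c] provides one, and the 1
   is arbitrary. *)
have neK : lex (C x) n `&` K !=set0.
  have [q _ qc] : exists2 q : rat, u n c - 1 < ratr q & ratr q < u n c.
    by apply: rat_lt; rewrite ltrBlDr ltrDl.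
  by have [P [lP [KP _]]] := B_le _ qc; exists P.
have [c' /set_mem[lc' Kc'] c'max] := compact_EVT_max neK
  (compact_closedI cl cK) (continuous_subspaceT (@u_cont n)).
exists c'; split => //; split => // Q lQ.
apply: (@le_trans _ _ (u n c)); first exact/cmax/mem_set.
(* A gap between the two maxima would contain a rational level that the stage reaches but [K] does
   not. *)
rewrite leNgt; apply/negP => /rat_lt[q c'q /B_le[P [lP [KP /= qP]]]].
by have := le_lt_trans (c'max P (mem_set (conj lP KP))) c'q; rewrite ltNge qP.
Qed.

Lemma lexmax_measurable K : closed K ->
  measurable [set x | lexmax (C x) `&` K !=set0].
Proof.
move=> cK; rewrite (_ : mkset _ = \bigcap_n [set x | lex (C x) n `&` K !=set0]).
  by apply: bigcapT_measurable => n; exact: lex_measurable.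
apply/seteqP; split => x /=.
  by move=> /(lexmaxI (@C_compact x) (C_ne x) cK) + n _; exact.
by move=> H; apply/(lexmaxI (@C_compact x) (C_ne x) cK) => n; exact: H.
Qed.

End lexicographic_argmax.

(** * Weakly continuous functionals and measurable selection *)

Section weak_topology.
Context {R : realType} {T : ptopologicalType}.

Lemma prob_int_continuous (f : Cb R T) :
  continuous (fun P : prob R T => prob_int P f).
Proof.
move=> P; pose i (P : prob R T) : {ptws Cb R T -> R} := prob_int P.
have ci : continuous i by exact: (@initial_continuous _ _ (@prob_int R T)).
have FF : Filter (i @ P) by apply: fmap_filter; exact: nbhs_filter.
have /cvg_sup/(_ f) Hf := ci P.
move=> A; rewrite nbhsE => -[B [oB BP] BA].
have HB : nbhs P [set P' | B (prob_int P' f)].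
  by apply: (Hf [set g | B (g f)]); exists [set g | B (g f)]; split => //; exists B.
change (nbhs P [set P' | A (prob_int P' f)]).
by apply: filterS HB => P' BP'; exact: BA.
Qed.

Lemma Cb_measurable (f : Cb R T) : measurable_fun [set: borel T] (sval f : borel T -> R).
Proof. by case: f => f [cf bf]; exact: (@borel_continuous_measurable R T f cf). Qed.

Lemma Cb_integrable (P : prob R T) (f : Cb R T) :
  P.-integrable [set: borel T] (EFin \o (sval f : borel T -> R)).
Proof.
case: f (Cb_measurable f) => f [cf [M fM]] /= mf.
apply: (@le_integrable _ _ _ P _ measurableT _ (EFin \o cst M)) => //.
- exact/measurable_EFinP.
- by move=> x _; rewrite /= lee_fin (le_trans (fM x))// ler_norm.
- exact: finite_measure_integrable_cst.
Qed.

Lemma prob_intE (P : prob R T) (f : Cb R T) :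
  ((prob_int P f)%:E = \int[P]_x (sval f x)%:E)%E.
Proof.
rewrite /prob_int /Rintegral fineK//.
exact: (integrable_fin_num measurableT (Cb_integrable P f)).
Qed.

Lemma measurable_prob_int (f : Cb R T) :
  measurable_fun [set: borel (prob R T)]
    ((fun P : prob R T => prob_int P f) : borel (prob R T) -> R).
Proof. by apply: (@borel_continuous_measurable R (prob R T)); exact: prob_int_continuous. Qed.

End weak_topology.

Section selection.
Context {R : realType} {T : ptopologicalType} {I : countType} (h : I -> T -> R).
Hypothesis h_cont : forall i, continuous (h i).
Hypothesis h_ge0 : forall i x, 0 <= h i x.
Hypothesis h_gen : @open T `<=` <<s range (fun i => [set x | 0 < h i x]) >>.

(** On the pi-system of spike supports the evaluation is a pointwise limit of weakly continuous
    functionals; a Dynkin argument reaches all Borel sets. *)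
Lemma measurable_prob_set (A : set (borel T)) : measurable A ->
  measurable_fun [set: borel (prob R T)]
    ((fun P : prob R T => P A) : borel (prob R T) -> \bar R).
Proof.
move=> mA.
pose G := range (@spike_supp R T I h).
have gen : @measurable _ (borel T) = <<s G >> by exact: borel_generated.
rewrite gen in mA.
move: A mA; apply: (dynkin_induction gen).
- exact: spike_supp_setI.
- by under eq_fun do rewrite probability_setT; exact: measurable_cst.
- move=> _ [l _ <-].
  pose u n (P : prob R T) := (prob_int P (spike_Cb h_cont h_ge0 (n, l)))%:E : \bar R.
  apply: (@emeasurable_fun_cvg _ (borel (prob R T)) R _ u).
    by move=> n; apply/measurable_EFinP; exact: measurable_prob_int.
  move=> P _; rewrite /u; under eq_fun do rewrite prob_intE.
  exact: spike_int_cvg.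
- move=> S mS IH.
  rewrite (_ : (fun P : prob R T => P (~` S)) = (fun P : prob R T => 1 - P S)%E).
    exact: emeasurable_funB.
  by apply/funext => P; rewrite probability_setC.
- move=> F mF tF IH.
  rewrite (_ : (fun P : prob R T => P (\bigcup_k F k)) =
    (fun P : prob R T => \sum_(k <oo) P (F k))%E).
    by apply: ge0_emeasurable_sum.
  by apply/funext => P; rewrite measure_bigcup//; apply: eq_eseriesl => k; rewrite in_setT.
Qed.

Lemma prob_ext (P Q : prob R T) :
  (forall p, prob_int P (spike_Cb h_cont h_ge0 p) = prob_int Q (spike_Cb h_cont h_ge0 p)) ->
  P = Q.
Proof.
move=> PQ; apply: prob_eqP.
apply: (spike_measure_unique h_cont h_ge0 h_gen) => [||p].
- exact: etrans (probability_setT P) (esym (probability_setT Q)).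
- by apply: le_lt_trans (ltry 1); rewrite -(probability_setT P).
- by have := congr1 EFin (PQ p); rewrite !prob_intE.
Qed.

(* Lexicographic maximization over a separating sequence of functionals leaves
   a single measure, so that [lexmax_measurable] becomes measurability of the
   selection. *)
Lemma measurable_selection d (S : measurableType d) (C : S -> set (prob R T)) :
  (forall x, C x !=set0) -> (forall x, compact (C x)) ->
  (forall K, closed K -> measurable [set x | C x `&` K !=set0]) ->
  exists Q : S -> prob R T, measurable_fun [set: S] (Q : S -> borel (prob R T)) /\
    forall x, C x (Q x).
Proof.
move=> C0 cC mC.
(* A number that decodes to nothing gets the spike of the empty list: its functional is constantly 1
   and discards no measure. *)
pose u n (P : prob R T) :=
  prob_int P (spike_Cb h_cont h_ge0 (odflt (0%N, [::]) (unpickle n))).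
have cu n : continuous (u n) by exact: prob_int_continuous.
have L1 x P P' : lexmax u (C x) P -> lexmax u (C x) P' -> P = P'.
  move=> lP lP'; apply: prob_ext => p.
  by have := lexmax_values (pickle p) lP lP'; rewrite /u pickleK.
have /choice[Q CQ] : forall x, exists P, lexmax u (C x) P.
  by move=> x; exact: (lexmax_nonempty cu).
exists Q; split; last by move=> x; exact: lexmax_sub (CQ x).
have QK K : closed K -> measurable (Q @^-1` K).
  move=> cK; rewrite (_ : Q @^-1` K = [set x | lexmax u (C x) `&` K !=set0]).
    exact: lexmax_measurable.
  apply/seteqP; split => x /=; first by move=> KQ; exists (Q x).
  by move=> [P [lP KP]]; rewrite (L1 x (Q x) P).
apply: (@measurability _ _ S (borel (prob R T)) setT _ (@open (prob R T))) => //.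
move=> _ [U oU <-]; rewrite setTI -[U]setCK preimage_setC; apply: measurableC.
exact: (QK (~` U) (open_closedC oU)).
Qed.

End selection.

(** * Stopping, pasting and concatenation of path measures *)

Section disintegration.
Context d d' {R : realType} {Y : measurableType d} {Z : measurableType d'}.
Variables (mu : probability Y R) (k : Y -> probability Z R).
Hypothesis mk : forall A, measurable A -> measurable_fun setT (fun y => k y A).

(** To use composition of kernels, [mu] is regarded as a kernel from a one-point space and [k] as a
    kernel ignoring that point. *)
Let dkern (x : unit * Y) : {measure set Z -> \bar R} := k x.2.

Let measurable_dkern A : measurable A -> measurable_fun setT (dkern ^~ A).
Proof.
move=> mA; exact: (measurableT_comp (mk mA) measurable_snd).
Qed.

HB.instance Definition _ := isKernel.Build _ _ _ _ _ dkern measurable_dkern.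

Let kernelT x : dkern x setT = 1%E.
Proof. exact: probability_setT. Qed.

HB.instance Definition _ := Kernel_isProbability.Build _ _ _ _ _ dkern kernelT.

Let base (x : unit) : {measure set Y -> \bar R} := mu.

Let measurable_base A : measurable A -> measurable_fun setT (base ^~ A).
Proof. by move=> mA; exact: measurable_cst. Qed.

HB.instance Definition _ := isKernel.Build _ _ _ _ _ base measurable_base.

Let baseT x : base x setT = 1%E.
Proof. exact: probability_setT. Qed.

HB.instance Definition _ := Kernel_isProbability.Build _ _ _ _ _ base baseT.

Lemma integral_disintegration (nu : {measure set Z -> \bar R}) (f : Z -> \bar R) :
  (forall A, measurable A -> nu A = \int[mu]_y k y A)%E ->
  (forall z, 0 <= f z)%E -> measurable_fun setT f ->
  (\int[nu]_z f z = \int[mu]_y \int[k y]_z f z)%E.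
Proof.
move=> nuE f0 mf.
have := @integral_kcomp _ _ _ _ _ _ _ base dkern tt f f0 mf.
rewrite /= => <-; apply: eq_measure_integral => A mA _.
exact: nuE.
Qed.

End disintegration.

(** * Events and integrals of the past *)

Section past_sigma_algebra.
Context {R : realType} {X : ptopologicalType} (s : time R).
Notation path := (path_space R X).

Definition same_past (w w' : path) :=
  forall r : time R, set_val r <= set_val s -> w r = w' r.

(** The invariance holds for the generating cylinders and survives complements and countable
    unions. *)
Lemma past_invariant (A : set (past X s)) : measurable A ->
  forall w w', same_past w w' -> A w <-> A w'.
Proof.
move: A; apply: smallest_sub; last first.
  by move=> _ [r rs [B mB ->]] w w' ww'; rewrite /= ww'.
split => [w w' _|A HA w w' ww'|F HF w w' ww'] //=.
  have [H1 H2] := HA w w' ww'.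
  by split => -[_ nA]; split => // ?; apply: nA; tauto.
by split => -[n _ Fn]; exists n => //; have [H1 H2] := HF n w w' ww'; tauto.
Qed.

Lemma measurable_past_eval (r : time R) : set_val r <= set_val s ->
  measurable_fun [set: past X s] ((fun w : path => w r) : past X s -> borel X).
Proof.
move=> rs _ B mB; rewrite setTI; apply: sub_sigma_algebra.
by exists r => //; exists B.
Qed.

Lemma measurable_past_id :
  measurable_fun [set: borel path] (id : borel path -> past X s).
Proof. by move=> _ A mA; rewrite setTI; exact: (@past_borel R X s A mA). Qed.

Definition to_past (w : borel path) : past X s := w.

HB.instance Definition _ := isMeasurableFun.Build _ _ _ _ to_past measurable_past_id.

Lemma past_borel_fun d (T : measurableType d) (f : path -> T) :
  measurable_fun [set: past X s] (f : past X s -> T) ->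
  measurable_fun [set: borel path] (f : borel path -> T).
Proof. by move=> mf; exact: (measurableT_comp mf measurable_past_id). Qed.

Local Open Scope ereal_scope.
(** The image of a law under [to_past] is its restriction to the past, and the two restrictions
    coincide. *)
Lemma past_integral (P P' : prob R path) (f : path -> \bar R) (B : set (past X s)) :
  (forall A : set (past X s), measurable A -> P' A = P A) ->
  (forall w, 0 <= f w) ->
  measurable_fun [set: past X s] (f : past X s -> \bar R) ->
  measurable B ->
  \int[P']_(w in B) f w = \int[P]_(w in B) f w.
Proof.
move=> PP f0 mf mB.
have E (Q : prob R path) :
    \int[distribution Q to_past]_(w in B) f w = \int[Q]_(w in B) f w.
  rewrite ge0_integral_pushforward//.
  exact: measurable_funTS.
rewrite -!E; apply: (eq_measure_integral (distribution P to_past)) => A mA _.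
exact: (PP A mA).
Qed.

End past_sigma_algebra.

(** * Stopping a path and gluing two paths *)

Section path_surgery.
Context {R : realType} {X : ptopologicalType} (s : time R).
Notation path := (path_space R X).

Definition time_min (t : time R) : time R := clamp (Num.min (set_val t) (set_val s)).
Definition time_sub (t : time R) : time R := clamp (set_val t - set_val s).

Lemma time_min_continuous : continuous time_min.
Proof.
move=> t; apply: (@continuous_comp (time R) R (time R)
  (fun t => Num.min (set_val t) (set_val s)) clamp); last exact: clamp_continuous.
apply: (@continuous_min R (time R) (set_val : time R -> R) (cst (set_val s))).
  exact: val_continuous.
exact: cst_continuous.
Qed.

Lemma time_sub_continuous : continuous time_sub.
Proof.
move=> t; apply: (@continuous_comp (time R) R (time R)
  (fun t => set_val t - set_val s) clamp); last exact: clamp_continuous.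
apply: (@continuous_comp (time R) R R set_val (fun x => x - set_val s)).
  exact: val_continuous.
by apply: cvgB; [exact: cvg_id | exact: cvg_cst].
Qed.

Lemma time_minE (t : time R) : set_val (time_min t) = Num.min (set_val t) (set_val s).
Proof. by rewrite clampE// le_min !time_ge0. Qed.

Lemma time_min_le (t : time R) : set_val t <= set_val s -> time_min t = t.
Proof. by move=> ts; apply: time_inj; rewrite time_minE min_l. Qed.

Lemma time_subE (t : time R) : set_val s <= set_val t ->
  set_val (time_sub t) = set_val t - set_val s.
Proof. by move=> ts; rewrite clampE// subr_ge0. Qed.

Lemma time_addE (t : time R) : set_val (time_add s t) = set_val s + set_val t.
Proof. by []. Qed.

Lemma time_subK (t : time R) : set_val s <= set_val t -> time_add s (time_sub t) = t.
Proof. by move=> ts; apply: time_inj; rewrite time_addE time_subE// addrC subrK. Qed.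

Lemma time_addK (t : time R) : time_sub (time_add s t) = t.
Proof.
apply: time_inj; rewrite time_subE ?time_addE ?lerDl ?time_ge0//.
by rewrite addrC addKr.
Qed.

Definition stop (w : path) : path := w \o mkcts time_min_continuous.

Lemma stopE w t : stop w t = w (time_min t).
Proof. by []. Qed.

Lemma stop_same_past w : same_past s w (stop w).
Proof. by move=> r rs; rewrite stopE time_min_le. Qed.

(* When [v] does not start at [w s] the value is irrelevant; stopping [w] keeps
   the dependence on [w] confined to its past. *)
Definition paste_fun (w v : path) (t : time R) : X :=
  if `[< v (time0 R) = w s >] then
    if set_val t <= set_val s then w t else v (time_sub t)
  else stop w t.

Lemma paste_continuous w v : continuous (paste_fun w v).
Proof.
rewrite /paste_fun; case: asboolP => [vw|_]; last exact: path_continuous.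
have ca : continuous (fun t => v (time_sub t)).
  move=> t; apply: (@continuous_comp (time R) (time R) X time_sub v).
    exact: time_sub_continuous.
  exact: path_continuous.
move=> t U /= Ut.
change (nbhs t [set t' | U (if set_val t' <= set_val s then w t' else v (time_sub t'))]).
have [ts|st|ts] := ltgtP (set_val t) (set_val s).
- rewrite ltW// in Ut.
  have wU : nbhs t [set t' | U (w t')] by exact: (@path_continuous _ _ w t).
  have tn : nbhs t [set t' | set_val t' < set_val s].
    by apply: (@val_continuous R t [set y | y < set_val s]); exact: lt_nbhsl.
  by apply: filterS (filterI wU tn) => t' /= [? /ltW ->].
- rewrite leNgt st/= in Ut.
  have vU : nbhs t [set t' | U (v (time_sub t'))] by exact: (ca t).
  have tn : nbhs t [set t' | set_val s < set_val t'].
    by apply: (@val_continuous R t [set y | set_val s < y]); exact: lt_nbhsr.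
  by apply: filterS (filterI vU tn) => t' /= [?]; rewrite ltNge => /negbTE ->.
(* At the seam both formulas take the value [w s], because [v] starts there. *)
- have {}ts := time_inj ts; rewrite {}ts lexx in Ut *.
  have v0 : v (time_sub s) = w s.
    by rewrite -vw; congr (v _); apply: time_inj; rewrite time_subE// subrr.
  have wU : nbhs s [set t' | U (w t')] by exact: (@path_continuous _ _ w s).
  have vU : nbhs s [set t' | U (v (time_sub t'))] by apply: (ca s); rewrite v0.
  by apply: filterS (filterI wU vU) => t' [? ?] /=; case: ifP.
Qed.

Definition paste (w v : path) : path := mkcts (@paste_continuous w v).

Lemma pasteE w v : paste w v = paste_fun w v :> (time R -> X).
Proof. by []. Qed.

Lemma paste_same_past w v : same_past s w (paste w v).
Proof.
move=> r rs; rewrite pasteE /paste_fun; case: asboolP => _.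
  by rewrite rs.
exact: stop_same_past.
Qed.

Lemma shift_paste (w v : path) : v (time0 R) = w s -> Defs.shift s (paste w v) = v.
Proof.
move=> vw; apply/continuousEP => t.
rewrite shiftE pasteE /paste_fun asboolT//.
case: ifPn => [|_]; last by rewrite time_addK.
(* After the shift the first branch survives only at time 0. *)
rewrite time_addE gerDl => t0.
have -> : t = time0 R.
  by apply: time_inj; apply/eqP; rewrite eq_le t0 time_ge0.
rewrite vw; congr (w _); apply: time_inj.
by rewrite time_addE addr0.
Qed.

End path_surgery.

Lemma probability_eq_on {d} {T : measurableType d} {R : realType}
    (P : probability T R) (N A B : set T) :
  measurable N -> measurable A -> measurable B -> P N = 1%E ->
  A `&` N = B `&` N -> P A = P B.
Proof.
move=> mN mA mB PN AB.
have E C : measurable C -> P C = P (C `&` N).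
  move=> mC; rewrite [LHS](measureDI P mC mN) -[RHS]add0e; congr (_ + _)%E.
  have PN0 : P (~` N) = 0%E by rewrite probability_setC// PN subee.
  apply/eqP; rewrite -measure_le0 -[leRHS]PN0; apply: le_measure.
  - by rewrite inE; exact: measurableD.
  - by rewrite inE; exact: measurableC.
  - by move=> x [].
transitivity (P (A `&` N)); first exact: E.
by rewrite AB; exact/esym/E.
Qed.

(** * Construction of the concatenated law *)

Section concatenation.
Context {R : realType} {X : ptopologicalType} (d : X -> X -> R).
Hypothesis d_metric : is_metric d.
Hypothesis d_nbhs : metrizes d.
Variable e : nat -> X.
Hypothesis e_dense : dense (range e).
Notation path := (path_space R X).

(** Each generator [path_hat] depends on a single coordinate. *)
Lemma measurable_to_path {dS} {S : measurableType dS} (g : S -> path) :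
  (forall t, measurable_fun setT (fun x => g x t : borel X)) ->
  measurable_fun setT (g : S -> borel path).
Proof.
move=> mg; apply: (@measurability _ _ S (borel path) setT _
  (range (fun i => [set w | 0 < path_hat d e i w]))).
  apply/seteqP; split.
    apply: smallest_sub; first exact: smallest_sigma_algebra.
    exact: path_hat_generates.
  apply: smallest_sub; first exact: sigma_algebra_measurable.
  move=> _ [i _ <-]; apply: sub_sigma_algebra.
  have /continuousP := path_hat_continuous d_metric d_nbhs (e := e) (i := i).
  by move=> /(_ [set y | 0 < y]); apply; exact: open_gt.
move=> _ [_ [i _ <-] <-]; rewrite setTI.
have -> : g @^-1` [set w | 0 < path_hat d e i w] =
  (fun x => g x (tick i.1)) @^-1` [set x | 0 < hat d e i.2 x] by [].
rewrite -[X in measurable X]setTI; apply: mg => //.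
apply: sub_sigma_algebra.
have /continuousP := hat_continuous d_metric d_nbhs (e := e) (i := i.2).
by move=> /(_ [set y | 0 < y]); apply; exact: open_gt.
Qed.

Lemma measurable_eval (t : time R) :
  measurable_fun [set: borel path] ((fun w : path => w t) : borel path -> borel X).
Proof. exact: (continuous_borel (@path_eval_continuous R X t)). Qed.

Lemma measurable_point (x : X) : measurable ([set x] : set (borel X)).
Proof.
rewrite -[X in measurable X]setCK; apply: measurableC; apply: sub_sigma_algebra.
by rewrite openC; exact: (metric_closed1 d_metric d_nbhs).
Qed.

Lemma measurable_at (t : time R) (x : X) :
  measurable ([set w | w t = x] : set (borel path)).
Proof.
have := measurable_eval t; move=> /(_ measurableT _ (measurable_point x)).
by rewrite setTI.
Qed.

Variable s : time R.

Lemma measurable_stop :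
  measurable_fun [set: past X s] (@stop R X s : past X s -> borel path).
Proof.
apply: measurable_to_path => t.
have H : set_val (time_min s t) <= set_val s by rewrite time_minE ge_min lexx orbT.
exact: (measurable_past_eval H).
Qed.

(** The Galmarino test: such an [f] factors through [stop s], which reads only coordinates up to
    s. *)
Lemma past_measurable_of_invariant dT (T : measurableType dT) (f : path -> T) :
  measurable_fun [set: borel path] (f : borel path -> T) ->
  (forall w, f (stop s w) = f w) ->
  measurable_fun [set: past X s] (f : past X s -> T).
Proof.
move=> mf fs; have -> : f = f \o @stop R X s by apply/funext => w /=; rewrite fs.
exact: (measurableT_comp mf measurable_stop).
Qed.

Definition paste_at (w : path) : borel path -> borel path := paste s w.

Lemma measurable_paste_at w : measurable_fun [set: borel path] (paste_at w).
Proof.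
apply: measurable_to_path => t; rewrite /paste_at.
have -> : (fun v => paste s w v t) =
   (fun v : borel path => if `[< (v : path) (time0 R) = w s >] then
      (if set_val t <= set_val s then w t else (v : path) (time_sub s t)) else stop s w t).
  by [].
apply: measurable_fun_ifT.
- apply: (measurable_fun_bool true); rewrite setTI.
  have -> : (fun v : borel path => `[< (v : path) (time0 R) = w s >]) @^-1` [set true] =
      [set v | v (time0 R) = w s].
    by apply/funext => v; apply/propext; split => /= /asboolP.
  exact: measurable_at.
- by case: (set_val t <= set_val s); [exact: measurable_cst | exact: measurable_eval].
- exact: measurable_cst.
Qed.

HB.instance Definition _ w := isMeasurableFun.Build _ _ _ _ _ (measurable_paste_at w).


Section kernel_of_paste.
Variable Q : X -> prob R path.
Hypothesis mQ : measurable_fun [set: borel X] (Q : borel X -> borel (prob R path)).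
Hypothesis Q0 : forall x, Q x [set w : path | w (time0 R) = x] = 1%E.

(** The law of the path that follows [w] up to s and then a random path drawn from [Q (w s)]; it
    will be the conditional law of the concatenation. *)
Definition paste_kernel (w : path) : prob R path :=
  normalize (distribution (Q (w s)) (paste_at w)).

Lemma paste_kernelE w (A : set (borel path)) : measurable A ->
  paste_kernel w A = Q (w s) (paste s w @^-1` A).
Proof. exact: normalizeE. Qed.

(** The past event is decided by [w] alone. The future event is tested on [v] itself, since
    [Q (w s)] gives full mass to the paths [v] starting at [w s], where [shift_paste] applies. *)
Lemma paste_kernel_rect w (A1 : set (past X s)) (A2 : set (borel path)) :
  measurable A1 -> measurable A2 ->
  paste_kernel w (A1 `&` @Defs.shift R X s @^-1` A2) = ((\1_A1 w)%:E * Q (w s) A2)%E.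
Proof.
move=> mA1 mA2.
have mA1b := past_borel mA1.
have mA2s : measurable (@Defs.shift R X s @^-1` A2 : set (borel path)).
  by have := @shift_measurable R X s measurableT A2 mA2; rewrite setTI.
have mI : measurable (A1 `&` @Defs.shift R X s @^-1` A2 : set (borel path)).
  exact: measurableI.
rewrite paste_kernelE// indicE.
have [wA|wA] := boolP (w \in A1); last first.
  rewrite mul0e (_ : _ @^-1` _ = set0) ?measure0//.
  apply/seteqP; split => v //= -[A1v _]; move/negP: wA; apply; apply/mem_set.
  exact: (past_invariant mA1 (@paste_same_past R X s w v)).2 A1v.
rewrite mul1e.
apply: (@probability_eq_on _ _ R (Q (w s)) [set v : path | v (time0 R) = w s]) => //.
- exact: measurable_at.
- by have := measurable_paste_at w measurableT mI; rewrite setTI.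
- apply/seteqP; split => v /= [+ v0]; rewrite shift_paste//; first by move=> [].
  move=> A2v; split => //; split => //.
  exact: (past_invariant mA1 (@paste_same_past R X s w v)).1 (set_mem wA).
Qed.

Lemma shift_law_paste_kernel w : shift_law s (paste_kernel w) = Q (w s).
Proof.
apply: prob_eqP => A mA; rewrite shift_lawE//.
have := paste_kernel_rect w (@measurableT _ (past X s)) mA.
by rewrite setTI indicT mul1e.
Qed.

Definition past_future : set (set (borel path)) :=
  [set A | exists A1 A2 : set path, [/\ measurable (A1 : set (past X s)),
     measurable (A2 : set (borel path)) & A = A1 `&` @Defs.shift R X s @^-1` A2]].

Lemma past_future_setI : setI_closed past_future.
Proof.
move=> _ _ [A1 [A2 [mA1 mA2 ->]]] [B1 [B2 [mB1 mB2 ->]]].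
exists (A1 `&` B1), (A2 `&` B2); split.
- exact: (@measurableI _ (past X s)).
- exact: (@measurableI _ (borel path)).
- by rewrite preimage_setI setIACA.
Qed.

(** A coordinate up to time s is a past event, and a later one is a coordinate of the shifted
    path. *)
Lemma past_future_generates : @measurable _ (borel path) = <<s past_future >>.
Proof.
apply/seteqP; split; last first.
  apply: smallest_sub; first exact: sigma_algebra_measurable.
  move=> _ [A1 [A2 [mA1 mA2 ->]]]; apply: measurableI; first exact: (past_borel mA1).
  by have := @shift_measurable R X s measurableT A2 mA2; rewrite setTI.
apply: smallest_sub; first exact: smallest_sigma_algebra.
move=> U /(path_hat_generates d_metric d_nbhs e_dense).
apply: smallest_sub; first exact: smallest_sigma_algebra.
move=> _ [i _ <-]; apply: sub_sigma_algebra.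
have mB : measurable ([set x | 0 < hat d e i.2 x] : set (borel X)).
  apply: sub_sigma_algebra.
  have /continuousP := hat_continuous d_metric d_nbhs (e := e) (i := i.2).
  by move=> /(_ [set y | 0 < y]); apply; exact: open_gt.
have [ts|ts] := leP (set_val (tick i.1)) (set_val s).
  exists [set w | 0 < path_hat d e i w], setT; split.
  - by have := @measurable_past_eval R X s _ ts; move=> /(_ measurableT _ mB); rewrite setTI.
  - exact: (@measurableT _ (borel path)).
  - by rewrite preimage_setT setIT.
exists setT, [set w : path | 0 < hat d e i.2 (w (time_sub s (tick i.1)))]; split.
- exact: (@measurableT _ (past X s)).
- by have := measurable_eval (time_sub s (tick i.1)); move=> /(_ measurableT _ mB); rewrite setTI.
- rewrite setTI; apply/funext => w; apply/propext => /=.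
  have E : Defs.shift s w (time_sub s (tick i.1)) = w (tick i.1).
    by rewrite shiftE time_subK// ltW.
  by rewrite /path_hat -E.
Qed.

Lemma measurable_Q (A : set (borel path)) : measurable A ->
  measurable_fun [set: past X s] ((fun w => Q (w s) A) : past X s -> \bar R).
Proof.
move=> mA.
have mP := measurable_prob_set (path_hat_continuous d_metric d_nbhs (e := e))
  (@path_hat_ge0 _ _ d e) (path_hat_generates d_metric d_nbhs e_dense) mA.
have mw := @measurable_past_eval R X s s (lexx _).
exact: (measurableT_comp mP (measurableT_comp mQ mw)).
Qed.

Lemma measurable_paste_kernel (A : set (borel path)) : measurable A ->
  measurable_fun [set: past X s] ((fun w => paste_kernel w A) : past X s -> \bar R).
Proof.
move=> mA; rewrite past_future_generates in mA.
move: A mA; apply: (dynkin_induction past_future_generates).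
- exact: past_future_setI.
- have -> : (fun w => paste_kernel w setT) = cst 1%E.
    by apply/funext => w; exact: probability_setT.
  exact: measurable_cst.
- move=> _ [A1 [A2 [mA1 mA2 ->]]].
  have -> : (fun w => paste_kernel w (A1 `&` @Defs.shift R X s @^-1` A2)) =
    (fun w => (\1_A1 w)%:E * Q (w s) A2)%E.
    by apply/funext => w; exact: paste_kernel_rect.
  apply: emeasurable_funM; last exact: measurable_Q.
  by apply/measurable_EFinP; exact: (@measurable_indic _ (past X s)).
- move=> S mS IH.
  have -> : (fun w => paste_kernel w (~` S)) = (fun w => 1 - paste_kernel w S)%E.
    by apply/funext => w; rewrite probability_setC.
  by apply: emeasurable_funB => //; exact: measurable_cst.
- move=> F mF tF IH.
  have -> : (fun w => paste_kernel w (\bigcup_k F k)) =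
    (fun w => \sum_(k <oo) paste_kernel w (F k))%E.
    by apply/funext => w; rewrite measure_bigcup//; apply: eq_eseriesl => k; rewrite in_setT.
  by apply: ge0_emeasurable_sum.
Qed.

Section concat.
Variable P : prob R path.
Local Open Scope ereal_scope.

Definition concat_measure (A : set (borel path)) : \bar R :=
  \int[P]_w paste_kernel w A.

Let concat0 : concat_measure set0 = 0.
Proof.
by rewrite /concat_measure; under eq_integral do rewrite measure0; rewrite integral0.
Qed.

Let concat_ge0 A : 0 <= concat_measure A.
Proof. exact: integral_ge0. Qed.

Let concat_sigma_additive : semi_sigma_additive concat_measure.
Proof.
move=> F mF tF mUF.
have -> : concat_measure (\bigcup_n F n) = \int[P]_w \sum_(n <oo) paste_kernel w (F n).
  apply: eq_integral => w _.
  by apply/esym/cvg_lim => //; exact: measure_semi_sigma_additive.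
apply/cvg_closeP; split.
  by apply: is_cvg_nneseries => n _ _; exact: integral_ge0.
rewrite closeE// integral_nneseries// => n.
apply: past_borel_fun; exact: measurable_paste_kernel.
Qed.

HB.instance Definition _ := isMeasure.Build _ _ _ concat_measure
  concat0 concat_ge0 concat_sigma_additive.

Let concatT : concat_measure setT = 1.
Proof.
rewrite /concat_measure; under eq_integral do rewrite probability_setT.
by rewrite integral_cst// mul1e; exact: (probability_setT P).
Qed.

HB.instance Definition _ :=
  Measure_isProbability.Build _ _ _ concat_measure concatT.

Definition concat : prob R path := normalize concat_measure.

Lemma concatE (A : set (borel path)) : measurable A ->
  concat A = \int[P]_w paste_kernel w A.
Proof. exact: normalizeE. Qed.

Lemma concat_past (A : set (past X s)) : measurable A -> concat A = P A.
Proof.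
move=> mA; rewrite concatE; last exact: (past_borel mA).
have -> : \int[P]_w paste_kernel w A = \int[P]_w (\1_A w)%:E.
  apply: eq_integral => w _.
  have := paste_kernel_rect w mA (@measurableT _ (borel path)).
  by rewrite preimage_setT setIT probability_setT mule1.
by rewrite integral_indic ?setIT//; exact: (past_borel mA).
Qed.

(** The pasted path has the past of [w], so a past event [B] factors out of the kernel as its
    indicator at [w]; the remaining integrand is past-measurable, where [P] and [concat] agree. *)
Lemma concat_rcpd : is_rcpd s concat paste_kernel.
Proof.
split; first exact: measurable_paste_kernel.
move=> A B mA mB; have mBb := past_borel mB.
rewrite concatE; last exact: measurableI.
rewrite (@past_integral _ _ s P concat (fun w => paste_kernel w A) B)//.
- rewrite [RHS]integral_mkcond; apply: eq_integral => w _.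
  rewrite patchE; case: ifPn => wB.
    rewrite !paste_kernelE//; last exact: measurableI.
    congr (Q (w s) _); apply/seteqP; split => v /= => [[]//|Av]; split => //.
    exact: (past_invariant mB (@paste_same_past R X s w v)).1 (set_mem wB).
  rewrite paste_kernelE//; last exact: measurableI.
  rewrite (_ : _ @^-1` _ = set0) ?measure0//.
  apply/seteqP; split => v //= -[_ Bv]; move/negP: wB; apply; apply/mem_set.
  exact: (past_invariant mB (@paste_same_past R X s w v)).2 Bv.
- by move=> C mC; exact: concat_past.
- exact: measurable_paste_kernel.
Qed.

Lemma concat_is_concat : is_concat s P (fun w => Q (w s)) concat.
Proof.
split; first exact: concat_past.
exists paste_kernel; first exact: concat_rcpd.
by apply: aeW => w; exact: shift_law_paste_kernel.
Qed.

End concat.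
End kernel_of_paste.

End concatenation.

(** * Laplace averages and their inversion *)

Section exponential_average.
Context {R : realType}.
Notation mu := (@lebesgue_measure R).
Implicit Types (D : set (measurableTypeR R)) (g h : measurableTypeR R -> R) (s t : R).

Definition exp_int D g : R := (\int[mu]_(t in D) (expR (- t) * g t))%R.

Definition bounded_meas D g :=
  measurable_fun D g /\ exists M, forall t, D t -> `|g t| <= M.

Notation pos := (`[0, +oo[%classic : set (measurableTypeR R)).

Let exp_integrable : mu.-integrable pos (EFin \o (fun t : R => expR (- t))).
Proof.
have /integrableP[_ H] := @integrable_exponential_pdf R 1 ltr01.
apply: (@eq_integrable _ _ _ mu pos _ (EFin \o exponential_pdf 1)) => //.
  move=> t; rewrite inE/= in_itv/= andbT => t0.
  by rewrite exponential_pdfE ?mul1r ?mulN1r.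
exact: (integrableS measurableT _ _ (@integrable_exponential_pdf R 1 ltr01)).
Qed.

Lemma exp_int_integrable D g : measurable D -> D `<=` pos -> bounded_meas D g ->
  mu.-integrable D (EFin \o (fun t => expR (- t) * g t)).
Proof.
move=> mD D0 [mg [M gM]].
have iD : mu.-integrable D (EFin \o (fun t : R => expR (- t))).
  exact: integrableS exp_integrable.
apply: (le_integrable mD _ _ (integrableZl mD M iD)).
- apply/measurable_EFinP; apply: measurable_funM => //.
  by case/integrableP: iD => /measurable_EFinP.
- move=> t Dt /=; rewrite lee_fin !normrM mulrC ler_pM// (le_trans (gM _ Dt))//.
  exact: ler_norm.
Qed.

Lemma exp_int_eq D g h :
  (forall t, D t -> g t = h t) -> exp_int D g = exp_int D h.
Proof. by move=> gh; apply: eq_Rintegral => t /set_mem Dt; rewrite gh. Qed.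

Lemma exp_intD D g h : measurable D -> D `<=` pos -> bounded_meas D g -> bounded_meas D h ->
  exp_int D (fun t => g t + h t) = exp_int D g + exp_int D h.
Proof.
move=> mD D0 bg bh; rewrite /exp_int -RintegralD//; try exact: exp_int_integrable.
by apply: eq_Rintegral => t _; rewrite mulrDr.
Qed.

Lemma exp_intZ D c g : measurable D -> D `<=` pos -> bounded_meas D g ->
  exp_int D (fun t => c * g t) = c * exp_int D g.
Proof.
move=> mD D0 bg; rewrite /exp_int -RintegralZl//; last exact: exp_int_integrable.
by apply: eq_Rintegral => t _; rewrite mulrCA.
Qed.

Lemma exp_int_le D g h : measurable D -> D `<=` pos -> bounded_meas D g -> bounded_meas D h ->
  (forall t, D t -> g t <= h t) -> exp_int D g <= exp_int D h.
Proof.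
move=> mD D0 bg bh gh; apply: le_Rintegral => //; try exact: exp_int_integrable.
by move=> t Dt; rewrite ler_wpM2l ?expR_ge0// gh.
Qed.

Lemma exp_int_ge0 D g : (forall t, D t -> 0 <= g t) -> 0 <= exp_int D g.
Proof. by move=> g0; apply: Rintegral_ge0 => t Dt; rewrite mulr_ge0 ?expR_ge0 ?g0. Qed.

Lemma exp_int1 : exp_int pos (cst 1) = 1.
Proof.
have H := @integral_exponential_pdf R 1 ltr01.
rewrite /exp_int /Rintegral; transitivity (fine (1%E : \bar R)) => //; congr fine.
rewrite -[RHS]H integral_mkcond; apply: eq_integral => t _.
rewrite /exponential_pdf !patchE; case: ifP => // _.
by rewrite /= mulr1 mul1r mulN1r.
Qed.

Lemma bounded_meas_cts D g M : measurable D -> continuous g ->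
  (forall t, D t -> `|g t| <= M) -> bounded_meas D g.
Proof.
move=> mD cg gM; split; last by exists M.
by apply: measurable_funTS; exact: continuous_measurable_fun.
Qed.

Lemma integral_translation (g : R -> R) s : continuous g -> (forall t, 0 <= g t) ->
  (\int[mu]_(t in `[s, +oo[) (g t)%:E = \int[mu]_(t in `[0%R, +oo[) (g (t + s))%:E)%E.
Proof.
move=> cg g0.
have dE : derive1 (fun t : R => t + s) = cst 1.
  by apply/funext => t; rewrite derive1E deriveD// derive_id derive_cst addr0.
have := @increasing_ge0_integration_by_substitutiony R (fun t => t + s) g 0.
rewrite /= add0r dE => ->.
- by apply: eq_integral => t _ /=; rewrite mulr1.
- by move=> x y _ _ xy; rewrite ltrD2r.
- by move=> t _; exact: cst_continuous.
- exact: is_cvg_cst.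
- exact: is_cvg_cst.
- split => [t _|].
    by apply: derivableD; [exact: derivable_id | exact: derivable_cst].
  apply: cvg_at_right_filter.
  by apply: cvgD; [exact: cvg_id | exact: cvg_cst].
- exact: cvg_addrr.
- exact: continuous_subspaceT.
- by [].
Qed.

(** The lack of memory of the exponential weight: translating the tail costs only the factor
    exp(-s). *)
Lemma exp_int_shift s g M : 0 <= s -> continuous g -> (forall t, 0 <= g t <= M) ->
  exp_int pos g = exp_int (`[0, s[)%classic g + expR (- s) * exp_int pos (fun t => g (s + t)).
Proof.
move=> s0 cg gM.
have bg D : measurable D -> bounded_meas D g.
  move=> mD; apply: (bounded_meas_cts mD cg (M := M)) => t _.
  by have /andP[g0 ?] := gM t; rewrite ger0_norm.
have posE : pos = `[0, s[%classic `|` `[s, +oo[%classic :> set R.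
  by rewrite -itv_bndbnd_setU// ?bnd_simp.
have m1 : measurable (`[0, s[%classic : set R) by [].
have sub1 : `[0, s[%classic `<=` pos.
  by move=> t /=; rewrite !in_itv/= => /andP[->].
have mp : measurable pos by [].
rewrite {1}/exp_int [in LHS]posE Rintegral_setU//; last 2 first.
- by rewrite -posE; apply: exp_int_integrable => //; exact: bg.
- rewrite disj_set2E; apply/eqP/seteqP; split => t //=.
  by rewrite !in_itv/= => -[/andP[_ ts]]; rewrite andbT leNgt ts.
congr (_ + _).
have cg' : continuous (fun t => g (s + t)).
  move=> t; apply: (@continuous_comp R R R (fun t => s + t) g); last exact: cg.
  by apply: cvgD; [exact: cvg_cst | exact: cvg_id].
rewrite -exp_intZ//; last first.
  apply: (bounded_meas_cts mp cg' (M := M)) => t _.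
  by have /andP[g0 ?] := gM (s + t); rewrite ger0_norm.
rewrite /exp_int /Rintegral; congr fine.
rewrite integral_translation.
- apply: eq_integral => t _; congr EFin.
  by rewrite mulrA -expRD opprD (addrC t s).
- move=> t; apply: cvgM; last exact: cg.
  apply: (@continuous_comp R R R -%R expR); last exact: continuous_expR.
  exact: continuousN.
- by move=> t; rewrite mulr_ge0 ?expR_ge0//; have /andP[] := gM t.
Qed.

End exponential_average.

(** * Recovering a value at a fixed time by polynomial kernels in exp(-t) *)

Section landau.
Context {R : realType}.
Notation pos := (`[0, +oo[%classic : set (measurableTypeR R)).

(* Truncated at negative times to be bounded on the whole of [R]. *)
Definition decay (t : R) : R := expR (- Num.max 0 t).

Lemma decay_gt0 t : 0 < decay t. Proof. exact: expR_gt0. Qed.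

Lemma decay_le1 t : decay t <= 1.
Proof. by rewrite -expR0 ler_expR lerNl oppr0 le_max lexx. Qed.

Lemma decayE t : 0 <= t -> decay t = expR (- t).
Proof. by move=> t0; rewrite /decay max_r. Qed.

Lemma decayD s t : 0 <= s -> 0 <= t -> decay (s + t) = decay s * decay t.
Proof. by move=> s0 t0; rewrite !decayE ?addr_ge0// opprD expRD. Qed.

Lemma decay_continuous : continuous decay.
Proof.
move=> t; apply: (@continuous_comp R R R (fun t => - Num.max 0 t) expR).
  apply: cvgN; apply: (@continuous_max R R (cst 0) id); first exact: cst_continuous.
  exact: cvg_id.
exact: continuous_expR.
Qed.

Lemma mpos : measurable pos. Proof. by []. Qed.

Lemma cts01_bounded (D : set (measurableTypeR R)) (g : R -> R) : measurable D ->
  continuous g -> (forall t, 0 <= g t <= 1) -> bounded_meas D g.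
Proof.
move=> mD cg g01; apply: (bounded_meas_cts mD cg (M := 1)) => t _.
by have /andP[? ?] := g01 t; rewrite ger0_norm.
Qed.

Lemma bounded_measZ (D : set (measurableTypeR R)) c (h : R -> R) :
  bounded_meas D h -> bounded_meas D (fun t => c * h t).
Proof.
move=> [mh [M hM]]; split; first exact: measurable_funM.
by exists (`|c| * M) => t Dt; rewrite normrM ler_wpM2l// hM.
Qed.

Lemma bounded_measD (D : set (measurableTypeR R)) (h1 h2 : R -> R) :
  bounded_meas D h1 -> bounded_meas D h2 -> bounded_meas D (fun t => h1 t + h2 t).
Proof.
move=> [m1 [M1 H1]] [m2 [M2 H2]]; split; first exact: measurable_funD.
by exists (M1 + M2) => t Dt; rewrite (le_trans (ler_normD _ _))// lerD ?H1 ?H2.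
Qed.

Lemma exp_int01 (g : R -> R) : continuous g -> (forall t, 0 <= g t <= 1) ->
  0 <= exp_int pos g <= 1.
Proof.
move=> cg g01; rewrite exp_int_ge0/=; last by move=> t _; have /andP[] := g01 t.
rewrite -[leRHS]exp_int1; apply: exp_int_le => //.
- exact: cts01_bounded.
- by apply: cts01_bounded => // t; [exact: cvg_cst | rewrite ler01 lexx].
- by move=> t _; have /andP[] := g01 t.
Qed.

Lemma exp_int_init s : 0 <= s -> exp_int (`[0, s[)%classic (cst 1) = 1 - expR (- s) :> R.
Proof.
move=> s0; apply/eqP; rewrite eq_sym subr_eq; apply/eqP.
rewrite -[LHS]exp_int1 (@exp_int_shift _ s (cst 1) 1)//.
- by congr (_ + _); rewrite -[RHS]mulr1; congr (_ * _); exact: exp_int1.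
- by move=> t; exact: cvg_cst.
- by move=> t; rewrite ler01 lexx.
Qed.

Lemma exp_int_poly (a : nat -> R) n (g : R -> R) :
  continuous g -> (forall t, 0 <= g t <= 1) ->
  exp_int pos (fun t => (\sum_(i < n) a i * decay t ^+ i) * g t) =
  \sum_(i < n) a i * exp_int pos (fun t => decay t ^+ i * g t).
Proof.
move=> cg g01.
have cdk i : continuous (fun t => decay t ^+ i * g t).
  move=> t; apply: cvgM; last exact: cg.
  apply: (@continuous_comp R R R decay (fun x => x ^+ i)).
    exact: decay_continuous.
  exact: exprn_continuous.
have dk01 i t : 0 <= decay t ^+ i * g t <= 1.
  have /andP[g0 g1] := g01 t; have d0 := ltW (decay_gt0 t).
  by rewrite mulr_ge0 ?exprn_ge0//= mulr_ile1 ?exprn_ge0// exprn_ile1// decay_le1.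
have bdk i : bounded_meas pos (fun t => decay t ^+ i * g t) by exact: cts01_bounded.
elim: n => [|n IH].
  rewrite big_ord0 (@exp_int_eq _ _ _ (fun t => 0 * g t)).
    by rewrite exp_intZ ?mul0r//; exact: cts01_bounded.
  by move=> t _; rewrite big_ord0.
rewrite big_ord_recr/= -IH -exp_intZ// -exp_intD//.
- by apply: exp_int_eq => t _; rewrite big_ord_recr/= mulrDl mulrA.
- elim: n {IH} => [|n IH].
    have -> : (fun t => (\sum_(i < 0) a i * decay t ^+ i) * g t) = (fun t => 0 * g t).
      by apply/funext => t; rewrite big_ord0.
    by apply: bounded_measZ; exact: cts01_bounded.
  have -> : (fun t => (\sum_(i < n.+1) a i * decay t ^+ i) * g t) =
      (fun t => (\sum_(i < n) a i * decay t ^+ i) * g t + a n * (decay t ^+ n * g t)).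
    by apply/funext => t; rewrite big_ord_recr/= mulrDl mulrA.
  by apply: bounded_measD => //; exact: bounded_measZ.
- exact: bounded_measZ.
Qed.

Variable t0 : R.
Hypothesis t0_ge0 : 0 <= t0.

Definition landau_poly (n : nat) : {poly R} := (1 - ('X - (decay t0)%:P) ^+ 2) ^+ n.

(* A Landau kernel in [x = exp (- t)]: a polynomial in [x], so that its integral
   against a path function is a combination of Laplace averages at integer
   rates, while it concentrates at [t0] as [n] grows. *)
Definition landau (n : nat) (t : R) : R := (1 - (decay t - decay t0) ^+ 2) ^+ n.

Lemma landauE n t : landau n t =
  \sum_(i < size (landau_poly n)) (landau_poly n)`_i * decay t ^+ i.
Proof. by rewrite -horner_coef /landau_poly !hornerE. Qed.

Lemma landau_base01 t : 0 <= 1 - (decay t - decay t0) ^+ 2 <= 1.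
Proof.
have := decay_gt0 t; have := decay_le1 t; have := decay_gt0 t0; have := decay_le1 t0.
move=> h1 h2 h3 h4; have h5 : (decay t - decay t0) ^+ 2 <= 1.
  rewrite -[leLHS](real_normK (num_real _)) exprn_ile1// ler_norml.
  by apply/andP; split; lra.
by rewrite subr_ge0 h5/= gerBl sqr_ge0.
Qed.

Lemma landau01 n t : 0 <= landau n t <= 1.
Proof.
have /andP[h0 h1] := landau_base01 t.
by rewrite exprn_ge0//= exprn_ile1.
Qed.

Lemma landau_continuous n : continuous (landau n).
Proof.
move=> t.
apply: (@continuous_comp R R R (fun t => 1 - (decay t - decay t0) ^+ 2) (fun x => x ^+ n)).
  apply: cvgB; first exact: cvg_cst.
  apply: (@continuous_comp R R R (fun t => decay t - decay t0) (fun x => x ^+ 2)).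
    by apply: cvgB; [exact: decay_continuous | exact: cvg_cst].
  exact: exprn_continuous.
exact: exprn_continuous.
Qed.

Let Z n := exp_int pos (landau n).

(** Only a short window to the right of [t0] is kept, since [t0] may be 0. On it [decay] moves by at
    most r/2; the halved radius makes this lower bound decay more slowly than the kernel does
    outside radius r. *)
Lemma landau_mass (r : R) : 0 < r -> r <= 1 ->
  exists2 c, 0 < c & forall n, c * (1 - (r / 2) ^+ 2) ^+ n <= Z n.
Proof.
move=> r0 r1.
have [eta eta0 Heta] : exists2 eta, 0 < eta & forall t, 0 <= t < eta ->
    `|decay (t0 + t) - decay t0| <= r / 2.
  have /cvgrPdist_lt/(_ _ (divr_gt0 r0 (ltr0n _ 2)))/nbhs_ballP[eta eta0 H] :=
    @decay_continuous t0.
  exists eta => // t /andP[t_ge0 te].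
  rewrite distrC; apply/ltW/H.
  by rewrite /ball/= opprD addNKr normrN ger0_norm.
(* The exponential mass of the window from [t0] to [t0 + eta]. *)
exists (expR (- t0) * (1 - expR (- eta))).
  by rewrite mulr_gt0 ?expR_gt0// subr_gt0 -expR0 ltr_expR oppr_lt0.
move=> n.
have cl : continuous (fun t => landau n (t0 + t)).
  move=> t; apply: (@continuous_comp R R R (fun t => t0 + t) (landau n)).
    by apply: cvgD; [exact: cvg_cst | exact: cvg_id].
  exact: landau_continuous.
rewrite /Z (exp_int_shift t0_ge0 (@landau_continuous n) (landau01 n)).
rewrite -mulrA; apply: ler_wpDl.
  by apply: exp_int_ge0 => t _; have /andP[] := landau01 n t.
rewrite ler_wpM2l ?expR_ge0// (exp_int_shift (ltW eta0) cl (fun t => landau01 n (t0 + t))).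
apply: ler_wpDr.
  rewrite mulr_ge0 ?expR_ge0//; apply: exp_int_ge0 => t _.
  by have /andP[] := landau01 n (t0 + (eta + t)).
have sub : `[0, eta[%classic `<=` pos.
  by move=> t /=; rewrite !in_itv/= => /andP[->].
have bc : bounded_meas (`[0, eta[)%classic (cst 1 : R -> R).
  by apply: cts01_bounded => // t; [exact: cvg_cst | rewrite ler01 lexx].
rewrite -(exp_int_init (ltW eta0)) mulrC -exp_intZ//.
apply: exp_int_le => //.
- exact: bounded_measZ.
- exact: (cts01_bounded _ cl (fun t => landau01 n (t0 + t))).
- move=> t; rewrite /= in_itv/= => te; rewrite mulr1; apply: lerXn2r.
  + rewrite nnegrE; nra.
  + by rewrite nnegrE; have /andP[] := landau_base01 (t0 + t).
  + rewrite lerD2l lerN2 -[leLHS](real_normK (num_real _)); apply: lerXn2r.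
    * by rewrite nnegrE.
    * by rewrite nnegrE; nra.
    * exact: Heta.
Qed.

(** Where [decay] is within r of its value at [t0], [g] varies by less than eps. Elsewhere the
    kernel is at most the last term, [g] varies by at most 1, and the total weight is 1. *)
Lemma landau_concentration (g : R -> R) (eps : R) : continuous g ->
  (forall t, 0 <= g t <= 1) -> 0 < eps ->
  exists r, [/\ 0 < r, r <= 1 & forall n,
    `|exp_int pos (fun t => landau n t * g t) - g t0 * Z n| <= eps * Z n + (1 - r ^+ 2) ^+ n].
Proof.
move=> cg g01 eps0.
have [r [r0 r1 Hr]] : exists r, [/\ 0 < r, r <= 1 & forall t, 0 <= t ->
    `|decay t - decay t0| < r -> `|g t - g t0| < eps].
  (* Closeness is measured in the variable exp(-t), so [g] is rewritten as a function of it. *)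
  have ck : {for decay t0, continuous (fun x => g (- ln x))}.
    apply: (@continuous_comp R R R (fun x => - ln x) g); last exact: cg.
    by apply: continuousN; exact: (continuous_ln (decay_gt0 t0)).
  have /cvgrPdist_lt/(_ _ eps0)/nbhs_ballP[r r0 H] := ck.
  (* The cap at 1 keeps [1 - r ^+ 2] nonnegative. *)
  exists (Num.min r 1); split; first by rewrite lt_min r0 ltr01.
    by rewrite ge_min lexx orbT.
  move=> t tge0; rewrite lt_min => /andP[tr _].
  have := H (decay t); rewrite /ball/= distrC => /(_ tr).
  by rewrite !decayE// !expRK !opprK distrC.
exists r; split => // n.
have rn0 : 0 <= (1 - r ^+ 2) ^+ n by rewrite exprn_ge0//; nra.
have cK := @landau_continuous n.
have cKg : continuous (fun t => landau n t * g t).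
  by move=> t; apply: cvgM; [exact: cK | exact: cg].
have Kg01 t : 0 <= landau n t * g t <= 1.
  by have /andP[? ?] := landau01 n t; have /andP[? ?] := g01 t; apply/andP; split; nra.
have bK : bounded_meas pos (landau n) := cts01_bounded mpos cK (landau01 n).
have bKg : bounded_meas pos (fun t => landau n t * g t) := cts01_bounded mpos cKg Kg01.
have b1 : bounded_meas pos (cst 1 : R -> R).
  by apply: cts01_bounded => // t; [exact: cvg_cst | rewrite ler01 lexx].
have bZ c (h : R -> R) : bounded_meas pos h -> bounded_meas pos (fun t => c * h t).
  exact: bounded_measZ.
have bD (h1 h2 : R -> R) : bounded_meas pos h1 -> bounded_meas pos h2 ->
    bounded_meas pos (fun t => h1 t + h2 t).
  exact: bounded_measD.
have pw t : pos t -> `|landau n t * g t - g t0 * landau n t| <=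
    eps * landau n t + (1 - r ^+ 2) ^+ n.
  rewrite /= in_itv/= andbT => tge0.
  have /andP[K0 K1] := landau01 n t.
  rewrite [g t0 * _]mulrC -mulrBr normrM (ger0_norm K0) mulrC.
  have [rt|rt] := ltP `|decay t - decay t0| r.
    by rewrite ler_wpDr// ler_wpM2r// ltW// Hr.
  apply: ler_wpDl; first by rewrite mulr_ge0// ltW.
  apply: (@le_trans _ _ (landau n t)).
    rewrite ler_piMl//.
    have /andP[? ?] := g01 t; have /andP[? ?] := g01 t0.
    by rewrite ler_norml; apply/andP; split; lra.
  apply: lerXn2r; rewrite ?nnegrE.
  - by have /andP[] := landau_base01 t.
  - nra.
  - rewrite lerD2l lerN2 -[leRHS](real_normK (num_real _)); apply: lerXn2r => //.
    by rewrite nnegrE ltW.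
have E : eps * Z n + (1 - r ^+ 2) ^+ n =
    exp_int pos (fun t => eps * landau n t + (1 - r ^+ 2) ^+ n * (cst 1 : R -> R) t).
  rewrite exp_intD ?exp_intZ//; try exact: bZ.
  by rewrite exp_int1 mulr1.
have bB : bounded_meas pos
    (fun t => eps * landau n t + (1 - r ^+ 2) ^+ n * (cst 1 : R -> R) t).
  by apply: bD; exact: bZ.
have up : exp_int pos (fun t => landau n t * g t) <=
    g t0 * Z n + (eps * Z n + (1 - r ^+ 2) ^+ n).
  rewrite E /Z -exp_intZ// -exp_intD//; last exact: bZ.
  apply: exp_int_le => //; first by apply: bD => //; exact: bZ.
  by move=> t Dt; have := pw t Dt; rewrite ler_norml /= mulr1 => /andP[_ ?]; lra.
have lo : g t0 * Z n <=
    exp_int pos (fun t => landau n t * g t) + (eps * Z n + (1 - r ^+ 2) ^+ n).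
  rewrite E /Z -exp_intZ// -exp_intD//.
  apply: exp_int_le => //; [exact: bZ | exact: bD |].
  by move=> t Dt; have := pw t Dt; rewrite ler_norml /= mulr1 => /andP[? _]; lra.
by rewrite ler_norml; apply/andP; split; lra.
Qed.

Lemma landau_mass_gt0 n : 0 < Z n.
Proof.
have [c c0 H] := landau_mass ltr01 (lexx _); apply: lt_le_trans (H n).
by rewrite mulr_gt0// exprn_gt0//; lra.
Qed.

(** Divided by the lower bound on the mass, the error from afar is geometric with ratio [q] below
    1. *)
Lemma landau_cvg (g : R -> R) : continuous g -> (forall t, 0 <= g t <= 1) ->
  exp_int pos (fun t => landau n t * g t) / exp_int pos (landau n) @[n --> \oo] --> g t0.
Proof.
move=> cg g01; apply/cvgrPdist_lt => eps eps0.
have e20 : 0 < eps / 2 by rewrite divr_gt0.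
have [r [r0 r1 H]] := landau_concentration cg g01 e20.
have [c c0 Hc] := landau_mass r0 r1.
have b0 : 0 < 1 - (r / 2) ^+ 2 by nra.
pose q := (1 - r ^+ 2) / (1 - (r / 2) ^+ 2).
have q01 : `|q| < 1.
  rewrite ger0_norm; last by rewrite divr_ge0//; nra.
  by rewrite ltr_pdivrMr// mul1r; nra.
have qn : c^-1 * q ^+ n @[n --> \oo] --> c^-1 * 0.
  by apply: cvgM; [exact: cvg_cst | exact: cvg_expr].
rewrite mulr0 in qn; move/cvgrPdist_lt/(_ _ e20): qn; apply: filterS => n.
rewrite sub0r normrN => qn.
have Z0 := landau_mass_gt0 n; rewrite -/(Z n) distrC.
have -> : exp_int pos (fun t => landau n t * g t) / Z n - g t0 =
    (exp_int pos (fun t => landau n t * g t) - g t0 * Z n) / Z n.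
  by rewrite mulrBl mulfK// gt_eqF.
rewrite normrM normfV (gtr0_norm Z0) ltr_pdivrMr//; apply: le_lt_trans (H n) _.
rewrite [X in _ < X * _](splitr eps) mulrDl ltrD2l.
apply: (@lt_le_trans _ _ ((eps / 2) * (c * (1 - (r / 2) ^+ 2) ^+ n))); last first.
  by rewrite ler_pM2l.
move: qn; rewrite ger0_norm; last first.
  by rewrite mulr_ge0 ?invr_ge0 ?(ltW c0)// exprn_ge0// divr_ge0 ?(ltW b0)//; nra.
move=> {}qn; rewrite /q expr_div_n mulrA ltr_pdivrMr ?exprn_gt0// ltr_pdivrMl// in qn.
by rewrite mulrCA.
Qed.

End landau.

(** * Discounted rewards of a path *)

Section discounted_functional.
Context {R : realType} {X : ptopologicalType} (f : X -> R).
Hypothesis f_cont : continuous f.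
Hypothesis f01 : forall x, 0 <= f x <= 1.
Notation path := (path_space R X).
Notation pos := (`[0, +oo[%classic : set (measurableTypeR R)).

Let run (w : path) (t : R) : R := f (w (clamp t)).

Let run_continuous w : continuous (run w).
Proof.
move=> t; apply: (@continuous_comp R (time R) R clamp (fun t => f (w t))).
  exact: clamp_continuous.
apply: (@continuous_comp (time R) X R w f); first exact: path_continuous.
exact: f_cont.
Qed.

Let run01 w t : 0 <= run w t <= 1. Proof. exact: f01. Qed.

Let integrand k w t := decay t ^+ k * run w t.

Let decayX_continuous k : continuous (fun t : R => decay t ^+ k).
Proof.
move=> t; apply: (@continuous_comp R R R decay (fun x => x ^+ k)).
  exact: decay_continuous.
exact: exprn_continuous.
Qed.

Let integrand_continuous k w : continuous (integrand k w).
Proof. by move=> t; apply: cvgM; [exact: decayX_continuous | exact: run_continuous]. Qed.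

Let integrand01 k w t : 0 <= integrand k w t <= 1.
Proof.
have /andP[g0 g1] := run01 w t; have d0 := ltW (decay_gt0 t).
by rewrite mulr_ge0 ?exprn_ge0//= mulr_ile1 ?exprn_ge0// exprn_ile1// decay_le1.
Qed.

(** The weight inside [exp_int] adds one factor, so the discount rate is k + 1; this is the exponent
    appearing in [disc_split]. *)
Definition disc (k : nat) (w : path) : R :=
  exp_int pos (fun t => decay t ^+ k * f (w (clamp t))).

Lemma disc01 k w : 0 <= disc k w <= 1.
Proof. exact: (exp_int01 (@integrand_continuous k w) (integrand01 k w)). Qed.

Lemma disc_split k (s : time R) w : disc k w =
  exp_int (`[0, set_val s[)%classic (fun t => decay t ^+ k * f (w (clamp t))) +
  decay (set_val s) ^+ k.+1 * disc k (Defs.shift s w).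
Proof.
rewrite /disc (exp_int_shift (time_ge0 s) (@integrand_continuous k w) (integrand01 k w)).
congr (_ + _); rewrite exprS -(decayE (time_ge0 s)) -mulrA; congr (_ * _).
rewrite -exp_intZ//; last first.
  exact: (cts01_bounded mpos (@integrand_continuous k (Defs.shift s w)) (integrand01 k _)).
apply: exp_int_eq => t; rewrite /= in_itv/= andbT => t0.
rewrite /integrand /run decayD ?time_ge0// exprMn -mulrA; congr (_ * (_ * f _)).
have -> : clamp (set_val s + t) = time_add s (clamp t) => //.
by apply: time_inj; rewrite time_addE !clampE// addr_ge0// time_ge0.
Qed.

Let window (T : R) : set (time R) := clamp @` `[0, T]%classic.

(** The weight has mass at most 1 before T, and the reward after T is at most exp(-T). *)
Let disc_le k (w w' : path) (eps T : R) : 0 <= eps -> 0 <= T ->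
  (forall t, 0 <= t <= T -> f (w' (clamp t)) <= f (w (clamp t)) + eps) ->
  disc k w' <= disc k w + (eps + expR (- T)).
Proof.
move=> e0 T0 H; pose s := clamp T.
have sE : set_val s = T by rewrite clampE.
rewrite (disc_split k s w') (disc_split k s w) sE.
have sub : `[0, T[%classic `<=` pos.
  by move=> t /=; rewrite !in_itv/= => /andP[->].
have mT : measurable (`[0, T[%classic : set (measurableTypeR R)) by [].
have bi w0 : bounded_meas (`[0, T[)%classic (integrand k w0).
  exact: (cts01_bounded mT (@integrand_continuous k w0) (integrand01 k w0)).
have bc : bounded_meas (`[0, T[)%classic (cst 1 : R -> R).
  by apply: cts01_bounded => // t; [exact: cvg_cst | rewrite ler01 lexx].
have h1 : exp_int (`[0, T[)%classic (integrand k w') <=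
    exp_int (`[0, T[)%classic (integrand k w) + eps * exp_int (`[0, T[)%classic (cst 1).
  rewrite -exp_intZ// -exp_intD//; last exact: bounded_measZ.
  apply: exp_int_le => //.
    by apply: bounded_measD => //; exact: bounded_measZ.
  move=> t; rewrite /= in_itv/= => /andP[t0 tT]; rewrite mulr1 /integrand.
  have dk0 : 0 <= decay t ^+ k by rewrite exprn_ge0// ltW// decay_gt0.
  have dk1 : decay t ^+ k <= 1 by rewrite exprn_ile1 ?decay_le1// ltW// decay_gt0.
  apply: (@le_trans _ _ (decay t ^+ k * (run w t + eps))).
    by rewrite ler_wpM2l// H// t0 ltW.
  by rewrite mulrDr lerD2l ler_piMl.
rewrite exp_int_init// in h1.
have /andP[d0 d1] := disc01 k (Defs.shift s w).
have /andP[d0' d1'] := disc01 k (Defs.shift s w').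
have c0 := decay_gt0 T; have c1 := decay_le1 T.
have ck : 0 <= decay T ^+ k.+1 <= expR (- T).
  rewrite -decayE// exprn_ge0 ?(ltW c0)//= exprS ler_piMr ?(ltW c0)//.
  by rewrite exprn_ile1// ltW.
have h2 : eps * (1 - expR (- T)) <= eps.
  by rewrite ler_piMr// gerBl expR_ge0.
have h3 : decay T ^+ k.+1 * disc k (Defs.shift s w') <= expR (- T).
  have /andP[a b] := ck; apply: le_trans b; rewrite ler_piMr//.
have h4 : 0 <= decay T ^+ k.+1 * disc k (Defs.shift s w).
  by rewrite mulr_ge0//; have /andP[] := ck.
rewrite /integrand/run in h1; lra.
Qed.

(** The half-line is locally compact: [w] sends a compact window around t into [U], and the paths
    doing so form an open set. *)
Let eval_joint (w : path) (t : time R) (U : set X) : open U -> U (w t) ->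
  exists (A : set (time R)) (B : set path),
    [/\ nbhs t A, nbhs w B & forall t' (w' : path), A t' -> B w' -> U (w' t')].
Proof.
move=> oU Ut.
have [r r0 rt] : exists2 r, 0 < r & forall t', `|set_val t - set_val t'| < r -> U (w t').
  by apply: time_nbhs_ball; apply: (@path_continuous _ _ w t); exact: open_nbhs_nbhs.
pose K := clamp @` `[set_val t - r / 2, set_val t + r / 2]%classic.
have cK : compact K.
  apply: continuous_compact; last exact: segment_compact.
  by apply: continuous_subspaceT; exact: clamp_continuous.
have r20 : 0 < r / 2 by rewrite divr_gt0.
exists [set t' | `|set_val t' - set_val t| < r / 2],
  [set w' : path | (w' : time R -> X) @` K `<=` U].
split; first by apply: near_time_ball; rewrite subrr normr0.
  apply: open_nbhs_nbhs; split.
    by exists [set g | g @` K `<=` U] => //; exact: compact_open_open.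
  move=> _ [_ [u /= + <-] <-]; rewrite in_itv/= => /andP[u1 u2]; apply: rt.
  have t0 := time_ge0 t.
  have [u0|u0] := leP 0 u.
    by rewrite clampE// ltr_norml; apply/andP; split; lra.
  (* The window may extend below 0; its negative part is clamped to 0, still within r of t. *)
  have -> : set_val (clamp u) = 0 by exact: (max_l (ltW u0)).
  by rewrite subr0 ger0_norm//; lra.
move=> t' w' /= t't; apply; exists t' => //; exists (set_val t'); last exact: clamp_val.
by move: t't; rewrite ltr_norml => /andP[? ?]; rewrite /= in_itv/=; apply/andP; split; lra.
Qed.

(** The tail beyond a large T is uniformly small, and on the compact window before T closeness in
    the compact-open topology makes the values of [f] along the paths uniformly close. *)
Lemma disc_continuous k : continuous (disc k).
Proof.
move=> w A /nbhs_ballP[eps /= eps0 HA].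
change (nbhs w [set w' | A (disc k w')]).
have e30 : 0 < eps / 3 by rewrite divr_gt0.
have [T T0 HT] : exists2 T, 0 <= T & expR (- T) < eps / 3.
  exists (Num.max 0 (1 - ln (eps / 3))); first by rewrite le_max lexx.
  rewrite -ltr_ln ?posrE ?expR_gt0// expRK ltrNl lt_max; apply/orP; right; lra.
have cW : compact (window T).
  apply: continuous_compact; last exact: segment_compact.
  by apply: continuous_subspaceT; exact: clamp_continuous.
have near_w : nbhs w [set w' : path |
    window T `<=` (fun t => `|f (w' t) - f (w t)| < eps / 3)].
  move/compact_near_coveringP: cW => cW.
  apply: (cW path (nbhs w) (fun (w' : path) t => `|f (w' t) - f (w t)| < eps / 3)) => t _.
  have e60 : 0 < eps / 3 / 2 by rewrite divr_gt0.
  pose U := [set x | `|f x - f (w t)| < eps / 3 / 2].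
  have oU : open U.
    rewrite (_ : U = f @^-1` (ball (f (w t)) (eps / 3 / 2))).
      by move/continuousP: f_cont; apply; exact: ball_open.
    by apply/seteqP; split => x /=; rewrite /ball/= distrC.
  have Ut : U (w t) by rewrite /U/= subrr normr0.
  have Hw : \forall t' \near t, U (w t').
    by apply: (@path_continuous _ _ w t); exact: open_nbhs_nbhs.
  have [V [B [tV wB VB]]] := eval_joint oU Ut.
  exists (V `&` [set t' | U (w t')], B); first by split => //; exact: filterI.
  move=> [t' w'] /= [[Vt' Ut'] Bw'].
  have := VB t' w' Vt' Bw'; rewrite /U/= => h.
  rewrite (splitr (eps / 3)) -[f (w' t')](subrK (f (w t))) -addrA.
  apply: le_lt_trans (ler_normD _ _) _; apply: ltrD => //.
  by rewrite distrC.
apply: filterS near_w => w' Hw'; apply: HA; rewrite /ball/=.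
have HT' t : 0 <= t <= T -> `|f (w' (clamp t)) - f (w (clamp t))| < eps / 3.
  by move=> tT; apply: Hw'; exists t => //; rewrite /= in_itv.
have up : disc k w' <= disc k w + (eps / 3 + expR (- T)).
  apply: disc_le => //; first exact: ltW.
  by move=> t /HT'; rewrite ltr_norml => /andP[? ?]; lra.
have lo : disc k w <= disc k w' + (eps / 3 + expR (- T)).
  apply: disc_le => //; first exact: ltW.
  by move=> t /HT'; rewrite ltr_norml => /andP[? ?]; lra.
by rewrite ltr_norml; apply/andP; split; lra.
Qed.

Lemma disc_bounded k : exists M, forall w, `|disc k w| <= M.
Proof. by exists 1 => w; have /andP[? ?] := disc01 k w; rewrite ger0_norm. Qed.

Definition disc_Cb k : Cb R path :=
  exist _ (disc k) (conj (@disc_continuous k) (disc_bounded k)).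

Lemma eval_cont t : continuous (fun w : path => f (w t)).
Proof.
move=> w; apply: (@continuous_comp path X R (fun w => w t) f).
  exact: path_eval_continuous.
exact: f_cont.
Qed.

Lemma eval_bounded t : exists M, forall w : path, `|f (w t)| <= M.
Proof. by exists 1 => w; have /andP[? ?] := f01 (w t); rewrite ger0_norm. Qed.

Definition eval_Cb t : Cb R path := exist _ _ (conj (@eval_cont t) (eval_bounded t)).

(** Laplace inversion. Normalized Landau averages are finite combinations of the [disc i] with
    coefficients independent of the law, and they converge boundedly to the value of [f] at time t.
    Working with finite combinations avoids exchanging the time and path integrals. *)
Lemma prob_int_disc_inj (P P' : prob R path) :
  (forall k, prob_int P (disc_Cb k) = prob_int P' (disc_Cb k)) ->
  forall t, prob_int P (eval_Cb t) = prob_int P' (eval_Cb t).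
Proof.
move=> PP t.
have t0 := time_ge0 t.
pose c n w := exp_int pos (fun u => landau (set_val t) n u * run w u) /
  exp_int pos (landau (set_val t) n).
have cE n : c n = (fun w => \sum_(i < size (landau_poly (set_val t) n))
    ((landau_poly (set_val t) n)`_i / exp_int pos (landau (set_val t) n)) * disc i w).
  apply/funext => w; rewrite /c.
  rewrite (@exp_int_eq _ _ _ (fun u => (\sum_(i < size (landau_poly (set_val t) n))
     (landau_poly (set_val t) n)`_i * decay u ^+ i) * run w u)); last first.
    by move=> u _; rewrite landauE.
  rewrite exp_int_poly//.
  rewrite mulr_suml; apply: eq_bigr => i _.
  by rewrite mulrAC.
have c01 n w : 0 <= c n w <= 1.
  have Z0 := landau_mass_gt0 t0 n.
  have cl := @landau_continuous R (set_val t) n.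
  have l01 := landau01 (set_val t) n.
  rewrite /c divr_ge0 ?(ltW Z0)//=; last first.
    apply: exp_int_ge0 => u _; rewrite mulr_ge0//.
      by have /andP[] := l01 u.
    by have /andP[] := run01 w u.
  rewrite ler_pdivrMr// mul1r; apply: exp_int_le => //.
  - apply: cts01_bounded => //.
      by move=> u; apply: cvgM; [exact: cl | exact: run_continuous].
    move=> u; have /andP[a b] := l01 u; have /andP[a' b'] := run01 w u.
    by rewrite mulr_ge0//= mulr_ile1.
  - exact: cts01_bounded.
  - move=> u _; have /andP[a b] := l01 u; have /andP[a' b'] := run01 w u.
    by rewrite ler_piMr.
have lin (Q : prob R path) (a : nat -> R) n :
    Q.-integrable [set: borel path]
      (EFin \o (fun w : borel path => \sum_(i < n) a i * disc i w)) /\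
    (\int[Q]_w (\sum_(i < n) a i * disc i w))%R = \sum_(i < n) a i * prob_int Q (disc_Cb i).
  elim: n => [|n [IH1 IH2]].
    have -> : (fun w : borel path => \sum_(i < 0) a i * disc i w) = cst 0.
      by apply/funext => w; rewrite big_ord0.
    split; first exact: finite_measure_integrable_cst.
    by rewrite big_ord0 Rintegral_cst// mul0r.
  have iD : Q.-integrable [set: borel path] (EFin \o (fun w : borel path => a n * disc n w)).
    exact: (integrableZl measurableT (a n) (Cb_integrable Q (disc_Cb n))).
  have -> : (fun w : borel path => \sum_(i < n.+1) a i * disc i w) =
     (fun w : borel path => \sum_(i < n) a i * disc i w + a n * disc n w).
    by apply/funext => w; rewrite big_ord_recr.
  split; first exact: (integrableD measurableT IH1 iD).
  rewrite RintegralD// IH2 big_ord_recr/=; congr (_ + _).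
  rewrite RintegralZl//; exact: (Cb_integrable Q (disc_Cb n)).
have cvgc (Q : prob R path) : (\int[Q]_w c n w)%R @[n --> \oo] --> prob_int Q (eval_Cb t).
  have mc n : measurable_fun [set: borel path] (c n : borel path -> R).
    by rewrite cE; have /integrableP[/measurable_EFinP] := (lin Q
       (fun i => (landau_poly (set_val t) n)`_i / exp_int pos (landau (set_val t) n))
       (size (landau_poly (set_val t) n))).1.
  have := @dominated_cvg _ _ _ Q setT measurableT (fun n w => (c n w)%:E)
    (fun w : borel path => (f (w t))%:E) (EFin \o cst 1).
  move=> H; apply/fine_cvg; rewrite fineK; last first.
    exact: (integrable_fin_num measurableT (Cb_integrable Q (eval_Cb t))).
  apply: H.
  - by move=> n; apply/measurable_EFinP.
  - move=> w _; apply/cvg_EFin; first exact: nearW.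
    have := landau_cvg t0 (@run_continuous w) (run01 w).
    by rewrite /run clamp_val.
  - by [].
  - exact: finite_measure_integrable_cst.
  - by move=> n w _; have /andP[? ?] := c01 n w; rewrite lee_fin ger0_norm.
apply: (cvg_unique _ (cvgc P)) => //.
have -> : (fun n => \int[P]_w c n w)%R = (fun n => \int[P']_w c n w)%R.
  apply/funext => n; rewrite cE.
  pose a i := (landau_poly (set_val t) n)`_i / exp_int pos (landau (set_val t) n).
  rewrite (lin P a _).2 (lin P' a _).2.
  by apply: eq_bigr => i _; rewrite PP.
exact: cvgc.
Qed.

End discounted_functional.

(** * Uniqueness of laws and the Markov selection *)

Section gap_cylinders.
Context {R : realType} {X : ptopologicalType} (d : X -> X -> R).
Hypothesis d_metric : is_metric d.
Hypothesis d_nbhs : metrizes d.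
Variable e : nat -> X.
Hypothesis e_dense : dense (range e).
Notation path := (path_space R X).

(* The times in [l] are increments: each entry constrains the path shifted by
   the preceding ones. *)
Fixpoint cyl (l : seq (time R * set (borel X))) : set (borel path) :=
  if l is (t, B) :: l' then
    [set w : path | B (w t)] `&` @Defs.shift R X t @^-1` cyl l'
  else setT.

Fixpoint mlist (l : seq (time R * set (borel X))) : Prop :=
  if l is (_, B) :: l' then measurable B /\ mlist l' else True.

Definition cyls : set (set (borel path)) := [set A | exists2 l, mlist l & A = cyl l].

Lemma shift_shift (s t : time R) (w : path) :
  Defs.shift t (Defs.shift s w) = Defs.shift (time_add s t) w.
Proof.
apply/continuousEP => r; rewrite !shiftE; congr (w _); apply: time_inj.
by rewrite !time_addE addrA.
Qed.

(** Increments keep the times ordered, so a new constraint is inserted either by splitting the first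
    gap or, past it, by recursion on the remaining time. *)
Lemma cyl_insert (t : time R) (B : set (borel X)) l : measurable B -> mlist l ->
  exists2 l', mlist l' & cyl l' = [set w : path | B (w t)] `&` cyl l.
Proof.
move=> mB; elim: l t => [|[t1 B1] l IH] t /=.
  by move=> _; exists [:: (t, B)] => //=; rewrite preimage_setT.
move=> [mB1 ml]; have [tt1|t1t] := leP (set_val t) (set_val t1).
  exists [:: (t, B), (time_sub t t1, B1) & l] => //=.
  have E (w : path) : Defs.shift t w (time_sub t t1) = w t1 by rewrite shiftE time_subK.
  have E2 (w : path) : Defs.shift (time_sub t t1) (Defs.shift t w) = Defs.shift t1 w.
    by rewrite shift_shift time_subK.
  apply/seteqP; split => w [Bw [B1w lw]]; split => //; split.
  - by have : B1 (Defs.shift t w (time_sub t t1)) := B1w; rewrite E.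
  - by have : cyl l (Defs.shift (time_sub t t1) (Defs.shift t w)) := lw; rewrite E2.
  - by have : B1 (w t1) := B1w; rewrite -E.
  - by have : cyl l (Defs.shift t1 w) := lw; rewrite -E2.
have [l' ml' l'E] := IH (time_sub t1 t) ml.
exists ((t1, B1) :: l') => //=; rewrite l'E.
have E (w : path) : Defs.shift t1 w (time_sub t1 t) = w t.
  by rewrite shiftE time_subK// ltW.
apply/seteqP; split => w.
  move=> [B1w [Bw lw]]; split; last by split.
  by have : B (Defs.shift t1 w (time_sub t1 t)) := Bw; rewrite E.
move=> [Bw [B1w lw]]; split => //; split => //.
by have : B (w t) := Bw; rewrite -E.
Qed.

(** The offset [t0] accumulates the increments of [l1] already read, turning each into an absolute
    time to insert in [l2]. *)
Lemma cyl_setI t0 l1 l2 : mlist l1 -> mlist l2 ->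
  exists2 l', mlist l' & cyl l' = @Defs.shift R X t0 @^-1` cyl l1 `&` cyl l2.
Proof.
elim: l1 t0 => [|[t B] l IH] t0 /=.
  by move=> _ ml2; exists l2 => //; rewrite preimage_setT setTI.
move=> [mB ml] ml2; have [l' ml' l'E] := IH (time_add t0 t) ml ml2.
have [l'' ml'' l''E] := cyl_insert (time_add t0 t) mB ml'.
exists l'' => //; rewrite l''E l'E.
have E2 (w : path) := shift_shift t0 t w.
apply/seteqP; split => w.
  move=> [Bw [lw l2w]]; split => //; split => //.
  by have : cyl l (Defs.shift (time_add t0 t) w) := lw; rewrite -E2.
move=> [[Bw lw] l2w]; split => //; split => //.
by have : cyl l (Defs.shift t (Defs.shift t0 w)) := lw; rewrite E2.
Qed.

Lemma shift0 (w : path) : Defs.shift (time0 R) w = w.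
Proof.
apply/continuousEP => r; rewrite shiftE; congr (w _); apply: time_inj.
by rewrite time_addE add0r.
Qed.

Lemma cyls_setI : setI_closed cyls.
Proof.
move=> _ _ [l1 m1 ->] [l2 m2 ->].
have [l ml lE] := cyl_setI (time0 R) m1 m2.
by exists l => //; rewrite lE; congr (_ `&` _); apply/seteqP; split => w /=; rewrite shift0.
Qed.

Lemma measurable_shift_preimage (t : time R) (A : set (borel path)) : measurable A ->
  measurable (@Defs.shift R X t @^-1` A : set (borel path)).
Proof. by move=> mA; have := @shift_measurable R X t measurableT A mA; rewrite setTI. Qed.

Lemma measurable_eval_preimage (t : time R) (B : set (borel X)) : measurable B ->
  measurable ([set w : path | B (w t)] : set (borel path)).
Proof. by move=> mB; have := @measurable_eval R X t measurableT B mB; rewrite setTI. Qed.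

Lemma measurable_cyl l : mlist l -> measurable (cyl l).
Proof.
elim: l => [_|[t B] l IH [mB ml]] /=; first exact: (@measurableT _ (borel path)).
apply: measurableI; first exact: measurable_eval_preimage.
by apply: measurable_shift_preimage; exact: IH.
Qed.

Lemma cyls_generate : @measurable _ (borel path) = <<s cyls >>.
Proof.
apply/seteqP; split; last first.
  apply: smallest_sub; first exact: sigma_algebra_measurable.
  by move=> _ [l ml ->]; exact: measurable_cyl.
apply: smallest_sub; first exact: smallest_sigma_algebra.
move=> U /(path_hat_generates d_metric d_nbhs e_dense).
apply: smallest_sub; first exact: smallest_sigma_algebra.
move=> _ [i _ <-]; apply: sub_sigma_algebra.
exists [:: (tick i.1, [set x | 0 < hat d e i.2 x])]; last first.
  by rewrite /= preimage_setT setIT.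
split => //; apply: sub_sigma_algebra.
have /continuousP := hat_continuous d_metric d_nbhs (e := e) (i := i.2).
by move=> /(_ [set y | 0 < y]); apply; exact: open_gt.
Qed.

Lemma prob_cyl_unique (P Q : prob R path) :
  (forall l, mlist l -> P (cyl l) = Q (cyl l)) -> P = Q.
Proof.
move=> PQ; apply: prob_eqP => A mA.
apply: (measure_unique cyls (fun=> setT)) => //.
- exact: cyls_generate.
- exact: cyls_setI.
- by move=> _; exists [::].
- by rewrite bigcup_const.
- by move=> _ [l ml ->]; exact: PQ.
- by move=> _; apply: le_lt_trans (ltry 1); rewrite -(probability_setT P).
Qed.

End gap_cylinders.

(** * Almost sure equality from integrals *)

Section almost_everywhere.
Context {dT : measure_display} {T : measurableType dT} {R : realType} (P : probability T R).
Variables a b : T -> R.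
Hypothesis ma : measurable_fun setT a.
Hypothesis mb : measurable_fun setT b.
Hypothesis a01 : forall w, 0 <= a w <= 1.
Hypothesis b01 : forall w, 0 <= b w <= 1.
Local Open Scope ereal_scope.

Lemma measurable_neq_set : measurable [set w | a w != b w].
Proof.
have -> : [set w | a w != b w] = ~` ((fun w => a w - b w)%R @^-1` [set 0%R]).
  apply/funext => w; apply/propext; rewrite /setC/=; split.
    by move=> /eqP ab /eqP; rewrite subr_eq0 => /eqP.
  by move=> H; apply/eqP => ab; apply: H; rewrite ab subrr.
apply: measurableC; rewrite -[X in measurable X]setTI.
by apply: measurable_funB => //; exact: measurable_set1.
Qed.

Let integrable01 (f : T -> R) : measurable_fun setT f -> (forall w, 0 <= f w <= 1)%R ->
  P.-integrable setT (EFin \o f).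
Proof.
move=> mf f01; apply: (@le_integrable _ _ _ P _ measurableT _ (EFin \o cst 1%R)) => //.
- exact/measurable_EFinP.
- by move=> x _; have /andP[? ?] := f01 x; rewrite /= lee_fin normr1 ger0_norm.
- exact: finite_measure_integrable_cst.
Qed.

Lemma eq_integral_null : P [set w | a w != b w] = 0 ->
  \int[P]_w (a w)%:E = \int[P]_w (b w)%:E.
Proof.
move=> N; apply: ge0_ae_eq_integral => //.
- exact/measurable_EFinP.
- exact/measurable_EFinP.
- by move=> w _; rewrite lee_fin; have /andP[] := a01 w.
- by move=> w _; rewrite lee_fin; have /andP[] := b01 w.
- exists [set w | a w != b w]; split => //; first exact: measurable_neq_set.
  by move=> w /= H; apply/eqP => ab; apply: H => _; rewrite ab.
Qed.

(** The difference [b - a] is almost surely nonnegative and its integral is at most 0. *)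
Lemma null_neq_of_integral_le (N : set T) : measurable N -> P N = 0 ->
  (forall w, ~ N w -> (a w <= b w)%R) ->
  \int[P]_w (b w)%:E <= \int[P]_w (a w)%:E -> P [set w | a w != b w] = 0.
Proof.
move=> mN PN ab ba.
have mc : measurable_fun setT (fun w => (b w - a w)%:E).
  by apply/measurable_EFinP; exact: measurable_funB.
have ia := integrable01 ma a01; have ib := integrable01 mb b01.
have c0 : \int[P]_w `|(b w - a w)%:E| = 0.
  apply/eqP; rewrite eq_le integral_ge0// andbT.
  rewrite (@ae_eq_integral _ _ _ P setT (fun w => (b w - a w)%:E))//.
  - under eq_integral do rewrite EFinB.
    rewrite integralB_EFin// sube_le0//.
  - exact: measurableT_comp.
  - exists N; split => // w /= H; apply: contrapT => /ab abw; apply: H => _.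
    by rewrite ger0_norm// subr_ge0.
have [H _] := @ae_eq_integral_abs _ _ _ P setT measurableT _ mc.
apply/(negligibleP _ measurable_neq_set).
apply: negligibleS (H c0) => w /= abw /(_ Logic.I) [] /eqP.
by rewrite subr_eq0 eq_sym => /eqP ba'; rewrite ba' eqxx in abw.
Qed.

End almost_everywhere.

Lemma integral_shift_law {R : realType} {X : ptopologicalType} (s : time R)
    (P : prob R (path_space R X)) (f : path_space R X -> \bar R) :
  measurable_fun [set: borel (path_space R X)] (f : borel (path_space R X) -> \bar R) ->
  (forall w, 0 <= f w)%E ->
  (\int[shift_law s P]_w f w = \int[P]_w f (Defs.shift s w))%E.
Proof.
move=> mf f0.
rewrite (eq_measure_integral (distribution P (@borel_shift R X s))).
  by rewrite ge0_integral_distribution.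
by move=> A mA _; exact: shift_lawE.
Qed.

(** * Dynamic programming and uniqueness of the maximizer *)

Section markov_selection.
Context {R : realType} {X : ptopologicalType} (d : X -> X -> R).
Hypothesis d_metric : is_metric d.
Hypothesis d_nbhs : metrizes d.
Variable e : nat -> X.
Hypothesis e_dense : dense (range e).
Notation path := (path_space R X).

Definition test_fun (p : nat * seq (nat * nat)) : X -> R := spike (hat d e) p.

Lemma test_fun_continuous p : continuous (test_fun p).
Proof. apply: spike_continuous => i; exact: hat_continuous. Qed.

Lemma test_fun01 p x : 0 <= test_fun p x <= 1.
Proof. by rewrite spike_ge0 ?spike_le1//; exact: hat_ge0. Qed.

(** The default pair codes the constant test function 1, whose reward is the same for every path. *)
Definition test_idx (n : nat) : (nat * seq (nat * nat)) * nat :=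
  odflt ((0%N, [::]), 0%N) (unpickle n).

Definition reward (n : nat) : Cb R path :=
  disc_Cb (@test_fun_continuous (test_idx n).1) (test_fun01 (test_idx n).1) (test_idx n).2.

Definition value (n : nat) (P : prob R path) : R := prob_int P (reward n).

Lemma value_continuous n : continuous (value n).
Proof. exact: (@prob_int_continuous R path (reward n)). Qed.

Lemma reward01 n w : 0 <= sval (reward n) w <= 1.
Proof. exact: (disc01 (@test_fun_continuous _) (test_fun01 _)). Qed.

Local Open Scope ereal_scope.

(** Inversion recovers the mean of every test function at time t, and the test functions separate
    measures on [X]. *)
Lemma value_marginal (P P' : prob R path) : (forall n, value n P = value n P') ->
  forall (t : time R) (B : set (borel X)), measurable B ->
  P [set w : path | B (w t)] = P' [set w : path | B (w t)].
Proof.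
move=> PP t B mB.
pose ev := (fun w : borel path => (w : path) t : borel X).
have mev : measurable_fun setT ev by exact: measurable_eval.
pose ev' : {mfun borel path >-> borel X} := MeasurableFun.Pack
  (MeasurableFun.Class (isMeasurableFun.Build _ _ _ _ ev mev)).
have E (Q : prob R path) p : \int[distribution Q ev']_x (test_fun p x)%:E =
    (prob_int Q (eval_Cb (@test_fun_continuous p) (test_fun01 p) t))%:E.
  rewrite prob_intE ge0_integral_distribution//.
    apply/measurable_EFinP; exact: (@borel_continuous_measurable R X _ (@test_fun_continuous p)).
  by move=> x; rewrite lee_fin; have /andP[] := test_fun01 p x.
apply: (@spike_measure_unique R X _ (hat d e) _ _ _
  (distribution P ev') (distribution P' ev') _ _ _ B mB).
- by move=> i; exact: hat_continuous.
- exact: hat_ge0.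
- exact: hat_generates.
- exact: etrans (probability_setT (distribution P ev'))
    (esym (probability_setT (distribution P' ev'))).
- by apply: le_lt_trans (ltry 1); rewrite -(probability_setT (distribution P ev')).
- move=> p; rewrite !E; congr (_%:E); apply: prob_int_disc_inj => k.
  by have := PP (pickle (p, k)); rewrite /value /reward /test_idx pickleK.
Qed.

Section dynamics.
Variable s : time R.

Lemma measurable_shift_law_value (k : path -> prob R path) n :
  (forall A : set (borel path), measurable A ->
     measurable_fun [set: past X s] ((fun w => k w A) : past X s -> \bar R)) ->
  measurable_fun [set: past X s]
    ((fun w => (value n (shift_law s (k w)))%:E) : past X s -> \bar R).
Proof.
move=> mk.
have -> : (fun w => (value n (shift_law s (k w)))%:E) =
    (fun w : past X s => \int[shift_law s (k w)]_v (sval (reward n) v)%:E).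
  by apply/funext => w; exact: prob_intE.
apply: (@measurable_fun_integral_kernel _ _ (past X s) (borel path) R
  (fun w => (shift_law s (k w) : {measure set (borel path) -> \bar R}))).
- move=> A mA.
  have -> : (fun w : past X s => shift_law s (k w) A) =
    (fun w : past X s => k w (@Defs.shift R X s @^-1` A)).
    by apply/funext => w; exact: shift_lawE.
  by apply: mk; exact: measurable_shift_preimage.
- by move=> z; rewrite lee_fin; have /andP[] := reward01 n z.
- by apply/measurable_EFinP; exact: Cb_measurable.
Qed.

Definition early (n : nat) (w : path) : R :=
  exp_int (`[0%R, set_val s[)%classic
    (fun t => decay t ^+ (test_idx n).2 * test_fun (test_idx n).1 (w (clamp t)))%R.

Definition discount (n : nat) : R := (decay (set_val s) ^+ (test_idx n).2.+1)%R.

Lemma discount_gt0 n : (0 < discount n)%R.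
Proof. by rewrite exprn_gt0// decay_gt0. Qed.

Lemma reward_split n w : (sval (reward n) w =
  early n w + discount n * sval (reward n) (Defs.shift s w))%R.
Proof. by rewrite /= (disc_split (@test_fun_continuous _) (test_fun01 _) _ s). Qed.

Lemma early_ge0 n w : (0 <= early n w)%R.
Proof.
apply: exp_int_ge0 => t _; apply: mulr_ge0.
  by rewrite exprn_ge0// ltW// decay_gt0.
by have /andP[] := test_fun01 (test_idx n).1 (w (clamp t)).
Qed.

Lemma measurable_reward_shift n : measurable_fun [set: borel path]
  ((fun w => sval (reward n) (Defs.shift s w)) : borel path -> R).
Proof.
exact: (measurableT_comp (Cb_measurable (reward n)) (@shift_measurable R X s)).
Qed.

(* No Fubini is needed: [early n] is a difference of Borel functions that is
   invariant under stopping at time [s]. *)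
Lemma measurable_early n :
  measurable_fun [set: past X s] (early n : past X s -> R).
Proof.
apply: (past_measurable_of_invariant d_metric d_nbhs e_dense).
  have -> : early n = (fun w => sval (reward n) w -
      discount n * sval (reward n) (Defs.shift s w))%R.
    by apply/funext => w; rewrite reward_split addrK.
  apply: measurable_funB; first exact: Cb_measurable.
  by apply: measurable_funM; [exact: measurable_cst | exact: measurable_reward_shift].
move=> w; apply: exp_int_eq => t ht.
have /andP[t0 ts] : (0 <= t < set_val s)%R by move: ht; rewrite /= in_itv.
have <- // : w (clamp t) = stop s w (clamp t).
by rewrite stopE time_min_le// clampE// ltW.
Qed.

(** Only the future part is disintegrated; the early part stays a past-measurable integrand,
    unaffected by a change of future. *)
Lemma value_split (P : prob R path) (k : path -> prob R path) n : is_rcpd s P k ->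
  (value n P)%:E = \int[P]_w (early n w)%:E +
    (discount n)%:E * \int[P]_w (value n (shift_law s (k w)))%:E.
Proof.
move=> [mk kE].
have me := past_borel_fun (@measurable_early n).
have mr := measurable_reward_shift n.
have r0 w : (0 <= sval (reward n) w)%R by have /andP[] := reward01 n w.
rewrite prob_intE; under eq_integral do rewrite reward_split EFinD EFinM.
rewrite ge0_integralD//.
- congr (_ + _); rewrite ge0_integralZl//.
  + congr (_ * _).
    rewrite (@integral_disintegration _ _ R (borel path) (borel path) P k _ P).
    * apply: eq_integral => w _; rewrite prob_intE integral_shift_law//.
        by apply/measurable_EFinP; exact: Cb_measurable.
    * by move=> A mA; apply: past_borel_fun; exact: mk.
    * by move=> A mA; have := kE A setT mA (@measurableT _ (past X s)); rewrite setIT.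
    * by move=> w; rewrite lee_fin.
    * exact/measurable_EFinP.
  + exact/measurable_EFinP.
  + by move=> w _; rewrite lee_fin.
  + by rewrite lee_fin ltW// discount_gt0.
- by move=> w _; rewrite lee_fin early_ge0.
- exact/measurable_EFinP.
- by move=> w _; rewrite -EFinM lee_fin mulr_ge0// ltW// discount_gt0.
- by apply: measurable_funeM; exact/measurable_EFinP.
Qed.

End dynamics.

Variable C : X -> set (prob R path).
Hypothesis C_nonempty : forall x, C x !=set0.
Hypothesis C_compact : forall x, compact (C x).
Hypothesis C_measurable : forall K : set (prob R path), closed K ->
  measurable ([set x | C x `&` K !=set0] : set (borel X)).
Hypothesis C_start : forall x P, C x P -> P [set w : path | w (time0 R) = x] = 1.
Hypothesis C_disintegrate : forall x P (s : time R), C x P ->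
  exists2 k, is_rcpd s P k &
    past_as s P (fun w : path => C (w s) (shift_law s (k w))).
Hypothesis C_concat : forall x P (s : time R) (Q : path -> prob R path), C x P ->
  past_measurable s Q -> (forall w : path, C (w s) (Q w)) ->
  forall P', is_concat s P Q P' -> C x P'.

Definition best (x : X) : set (prob R path) := lexmax value (C x).

Lemma best_selection : exists Q : X -> prob R path,
  measurable_fun [set: borel X] (Q : borel X -> borel (prob R path)) /\
  forall x, best x (Q x).
Proof.
apply: (measurable_selection (path_hat_continuous d_metric d_nbhs (e := e))
  (@path_hat_ge0 _ _ d e) (path_hat_generates d_metric d_nbhs e_dense)
  (S := borel X) (C := best)).
- by move=> x; exact: (lexmax_nonempty value_continuous (@C_compact x) (C_nonempty x)).
- by move=> x; exact: (lexmax_compact value_continuous (@C_compact x) (C_nonempty x)).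
- move=> K cK.
  exact: (lexmax_measurable value_continuous (S := borel X) (C := C)
    C_nonempty C_compact C_measurable cK).
Qed.

Lemma value01 n P : (0 <= value n P <= 1)%R.
Proof.
have r01 w : (0 <= sval (reward n) w <= 1)%R by exact: reward01.
have mr := Cb_measurable (reward n).
rewrite -!lee_fin prob_intE; apply/andP; split.
  by apply: integral_ge0 => w _; rewrite lee_fin; have /andP[] := r01 w.
have -> : 1%:E = \int[P]_w (cst 1 w).
  by rewrite integral_cst// mul1e; exact/esym/(probability_setT P).
apply: ge0_le_integral => //.
- by move=> w _; rewrite lee_fin; have /andP[] := r01 w.
- exact/measurable_EFinP.
- by move=> w _; rewrite lee_fin; have /andP[] := r01 w.
Qed.

Variable Q : X -> prob R path.
Hypothesis mQ : measurable_fun [set: borel X] (Q : borel X -> borel (prob R path)).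
Hypothesis bestQ : forall x, best x (Q x).

Lemma past_measurable_selection (s : time R) : past_measurable s (fun w => Q (w s)).
Proof.
move=> f; have mw := @measurable_past_eval R X s s (lexx _).
exact: (measurableT_comp (measurable_prob_int f) (measurableT_comp mQ mw)).
Qed.

(* Dynamic programming: replacing the conditional future by the maximizing
   selection cannot increase the value of an already optimal [P], so by induction
   on the rank of the functional the future was almost surely optimal. *)
Lemma best_disintegrate x P (s : time R) k : best x P -> is_rcpd s P k ->
  past_as s P (fun w : path => C (w s) (shift_law s (k w))) ->
  past_as s P (fun w : path => best (w s) (shift_law s (k w))).
Proof.
move=> Px rk [N [mN PN CN]].
have CQ y : C y (Q y) by exact: lexmax_sub (bestQ y).
have Q0 y := C_start (CQ y).
pose a n w := value n (shift_law s (k w)).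
pose b n (w : path) := value n (Q (w s)).
have map n : measurable_fun [set: past X s] (a n : past X s -> R).
  apply/measurable_EFinP; apply: measurable_shift_law_value; exact: rk.1.
have mbp n : measurable_fun [set: past X s] (b n : past X s -> R).
  exact: past_measurable_selection.
have ma n := past_borel_fun (map n).
have mb n := past_borel_fun (mbp n).
have a01 n w : (0 <= a n w <= 1)%R by exact: value01.
have b01 n w : (0 <= b n w <= 1)%R by exact: value01.
pose E n : set (past X s) := [set w | a n w != b n w].
have mE n : measurable (E n) by exact: (measurable_neq_set (map n) (mbp n)).
have mNb : measurable (N : set (borel path)) := past_borel mN.
have mEb i : measurable (E i : set (borel path)) := past_borel (mE i).
pose P' := concat d_metric d_nbhs e_dense s mQ Q0 P.
have concP : is_concat s P (fun w => Q (w s)) P' by exact: concat_is_concat.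
have CP' : C x P'.
  exact: (C_concat (lexmax_sub Px) (past_measurable_selection (s := s)) _ concP).
have valP n : (value n P)%:E =
    \int[P]_w (early s n w)%:E + (discount s n)%:E * \int[P]_w (a n w)%:E.
  exact: value_split.
have valP' n : (value n P')%:E =
    \int[P]_w (early s n w)%:E + (discount s n)%:E * \int[P]_w (b n w)%:E.
  have rk' : is_rcpd s P' (paste_kernel d_metric d_nbhs e_dense s Q) by exact: concat_rcpd.
  rewrite (value_split n rk'); congr (_ + _ * _).
    apply: (past_integral (P := P) (P' := P') (s := s)).
    - exact: concP.1.
    - by move=> w; rewrite lee_fin early_ge0.
    - by apply/measurable_EFinP; exact: measurable_early.
    - exact: (@measurableT _ (past X s)).
  rewrite -(past_integral concP.1 (f := fun w => (b n w)%:E) (B := setT)).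
  - apply: eq_integral => w _; congr (value n _)%:E; exact: shift_law_paste_kernel.
  - by move=> w; rewrite lee_fin; have /andP[] := b01 n w.
  - exact/measurable_EFinP.
  - exact: (@measurableT _ (past X s)).
(* Finiteness allows the common early term to be cancelled in the extended reals. *)
have fin_early n : \int[P]_w (early s n w)%:E \is a fin_num.
  rewrite ge0_fin_numE; last first.
    by apply: integral_ge0 => w _; rewrite lee_fin early_ge0.
  apply: (@le_lt_trans _ _ (value n P)%:E); last exact: ltry.
  rewrite valP leeDl// mule_ge0//; first by rewrite lee_fin ltW// discount_gt0.
  by apply: integral_ge0 => w _; rewrite lee_fin; have /andP[] := a01 n w.
have PE n : P (E n) = 0.
  elim/ltn_ind: n => n IH.
  (* For ranks below n the conditional values agree almost surely, so [P'] ties with [P] and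
     competes at rank n. *)
  have lexP' : lex value (C x) n P'.
    apply: (lex_eq (Px n Logic.I) CP') => i /IH PEi.
    apply: EFin_inj; rewrite valP valP'; congr (_ + _ * _).
    by apply/esym; exact: (eq_integral_null (ma i) (mb i)).
  have [_ /(_ _ lexP') valle] := Px n.+1 Logic.I.
  pose bad : set (borel path) := N `|` \bigcup_(i in [set i | (i < n)%N]) E i.
  have mbad : measurable bad.
    apply: measurableU; first exact: mNb.
    by apply: bigcup_measurable => i _; exact: mEb.
  have Pbad : P bad = 0.
    apply/negligibleP => //; apply: negligibleU.
      by apply/negligibleP => //; exact: mNb.
    rewrite bigcup_mkcond; apply: negligible_bigcup => i; case: ifPn => [|_].
      by rewrite inE => /IH PEi; apply/negligibleP => //; exact: mEb.
    exact: negligible_set0.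
  apply: (null_neq_of_integral_le (ma n) (mb n) (a01 n) (b01 n) mbad Pbad).
    (* Off [bad] the conditional future lies in stage n at [w s], so [Q (w s)] does at least as well
       for functional n. *)
    move=> w nbad; have [_ H] := bestQ (w s) (i := n.+1) Logic.I.
    apply: H; apply: (lex_eq (bestQ (w s) (i := n) Logic.I)).
      by apply: CN => Nw; apply: nbad; left.
    move=> i ni; apply/eqP/negPn/negP => Ei; apply: nbad; right.
    by exists i.
  move: valle; rewrite -lee_fin valP valP' leeD2lE//.
  by rewrite lee_pmul2l// ?lte_fin ?discount_gt0.
exists (N `|` \bigcup_n E n); split.
- by apply: (@measurableU _ (past X s)) => //; exact: bigcupT_measurable.
- apply/negligibleP.
    apply: measurableU; first exact: mNb.
    by apply: bigcupT_measurable => i; exact: mEb.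
  apply: negligibleU.
    by apply/negligibleP => //; exact: mNb.
  by apply: negligible_bigcup => i; apply/(negligibleP _ (mEb i)); exact: PE.
(* Outside one null set all values agree with those of [Q (w s)], which places the conditional
   future in every stage. *)
- move=> w nbad n _; apply: (lex_eq (bestQ (w s) (i := n) Logic.I)).
    by apply: CN => Nw; apply: nbad; left.
  move=> i _; apply/eqP/negPn/negP => Ei; apply: nbad; right.
  by exists i.
Qed.

(** The constraint at time t is a past event. The others bear on the conditional future, almost
    surely a maximizer from [w t], to which the hypothesis on [l] applies. *)
Lemma best_cyl_step x P (t : time R) (B : set (borel X)) l :
  measurable B -> mlist l ->
  (forall y P', best y P' -> P' (cyl l) = Q y (cyl l)) -> best x P ->
  P (cyl ((t, B) :: l)) = \int[P]_(w in [set w : path | B (w t)]) Q (w t) (cyl l).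
Proof.
move=> mB ml IH Px.
have [k rk Ck] := C_disintegrate t (lexmax_sub Px).
have [N [mN PN bN]] := best_disintegrate Px rk Ck.
have mc := measurable_cyl ml.
have ms := measurable_shift_preimage t mc.
have mBp : measurable ([set w : path | B (w t)] : set (past X t)).
  by have := @measurable_past_eval R X t t (lexx _) measurableT B mB; rewrite setTI.
have mBb := past_borel mBp; have mNb := past_borel mN.
rewrite /= setIC (rk.2 _ _ ms mBp).
have mQl := measurable_Q d_metric d_nbhs e_dense (s := t) mQ mc.
apply: ge0_ae_eq_integral => //.
- by apply: measurable_funTS; apply: past_borel_fun; exact: rk.1.
- by apply: measurable_funTS; exact: past_borel_fun mQl.
- exists N; split => // w /= H; apply: contrapT => /bN wb; apply: H => _.
  by rewrite -(IH _ _ wb) shift_lawE.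
Qed.

(** After one step the probability depends on [P] only through the law of the path at time t, which
    is common to all maximizers at x. *)
Lemma best_cyl l : mlist l -> forall x P, best x P -> P (cyl l) = Q x (cyl l).
Proof.
elim: l => [_|[t B] l IH [mB ml]] x P Px.
  exact: etrans (probability_setT P) (esym (probability_setT (Q x))).
have {}IH := IH ml.
rewrite (best_cyl_step t mB ml IH Px) (best_cyl_step t mB ml IH (bestQ x)).
pose ev := (fun w : borel path => (w : path) t : borel X).
have mev : measurable_fun setT ev by exact: measurable_eval.
pose ev' : {mfun borel path >-> borel X} := MeasurableFun.Pack
  (MeasurableFun.Class (isMeasurableFun.Build _ _ _ _ ev mev)).
have mphi : measurable_fun [set: borel X] (fun y : borel X => Q y (cyl l)).
  have mP := measurable_prob_set (path_hat_continuous d_metric d_nbhs (e := e))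
    (@path_hat_ge0 _ _ d e) (path_hat_generates d_metric d_nbhs e_dense)
    (measurable_cyl ml).
  exact: (measurableT_comp mP mQ).
have E (P0 : prob R path) : \int[P0]_(w in [set w : path | B (w t)]) Q (w t) (cyl l) =
    \int[distribution P0 ev']_(y in B) Q y (cyl l).
  by rewrite ge0_integral_pushforward//; exact: measurable_funTS.
rewrite !E; apply: eq_measure_integral => A mA _.
apply: value_marginal => // n; exact: lexmax_values Px (bestQ x).
Qed.

Lemma best_unique x P : best x P -> P = Q x.
Proof.
move=> Px; apply: (prob_cyl_unique d_metric d_nbhs e_dense) => l ml.
exact: best_cyl.
Qed.

End markov_selection.

Theorem theorem7 (R : realType) (X : ptopologicalType) (polishX : polish R X)
    (C : X -> set (prob R (path_space R X)))
    (C1 : forall x, [/\ C x !=set0, compact (C x) & convex_prob (C x)])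
    (C2 : forall K : set (prob R (path_space R X)), closed K ->
       measurable ([set x | C x `&` K !=set0] : set (borel X)))
    (C3 : forall x P, C x P -> P [set w : path_space R X | w (time0 R) = x] = 1%E)
    (MP1 : forall x P (s : time R), C x P ->
       exists2 k, is_rcpd s P k &
         past_as s P (fun w : path_space R X => C (w s) (shift_law s (k w))))
    (MP2 : forall x P (s : time R)
         (Q : path_space R X -> prob R (path_space R X)), C x P ->
       past_measurable s Q -> (forall w : path_space R X, C (w s) (Q w)) ->
       forall P', is_concat s P Q P' -> C x P') :
  exists P : X -> prob R (path_space R X),
    [/\ measurable_fun [set: borel X]
           (P : borel X -> borel (prob R (path_space R X))),
        forall x, C x (P x) &
        forall x (s : time R),
          exists2 k, is_rcpd s (P x) k &
            past_as s (P x) (fun w : path_space R X => shift_law s (k w) = P (w s))].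
Proof.
have [[D cD dD] [d [d_metric d_nbhs _]]] := polishX.
have [e e_dense] : exists e : nat -> X, dense (range e).
  have /countable_injP[g ginj] := cD.
  (* Numbers that code no element of [D] are sent to [point]; extra terms do not harm density. *)
  have /choice[e eE] : forall n : nat, exists x, forall y, D y -> g y = n -> x = y.
    move=> n; have [[y [Dy gy]]|H] := pselect (exists y, D y /\ g y = n).
      exists y => z Dz gz; apply: ginj; rewrite ?inE//.
      by rewrite gy gz.
    by exists point => y Dy gy; exfalso; apply: H; exists y.
  exists e => U U0 oU; have [y [Uy Dy]] := dD U U0 oU.
  by exists y; split => //; exists (g y) => //; exact: eE.
have C_ne x : C x !=set0 by have [] := C1 x.
have C_compact x : compact (C x) by have [] := C1 x.
have [Q [mQ bestQ]] := best_selection d_metric d_nbhs e_dense C_ne C_compact C2.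
exists Q; split=> [//|x|x s]; first exact: lexmax_sub (bestQ x).
have [k rk Ck] := MP1 x (Q x) s (lexmax_sub (bestQ x)).
exists k => //.
have [N [mN QN bN]] := best_disintegrate e_dense C3 MP2 mQ bestQ (bestQ x) rk Ck.
exists N; split => // w /bN wb.
exact: (best_unique e_dense C3 MP1 MP2 mQ bestQ wb).
Qed.
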